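(* Let $\mathfrak A$ be a finite automaton over the alphabet $\{0,1,\ldots,p-1\}$ with $m$ inputs and $n$ outputs, and let $G=(G_1;\ldots;G_n)\colon[\mathbf a,\mathbf b]=[a_1,b_1]\times\cdots\times[a_m,b_m]\to[0,1)^n$ (where $[a_i,b_i]\subset[0,1)$, $a_i<b_i$, for $i=1,\ldots,m$, and $G_j\colon[\mathbf a,\mathbf b]\to[0,1)$ for $j=1,\ldots,n$) be a two times differentiable function all of whose second partial derivatives are continuous on $[\mathbf a,\mathbf b]$. If $\mathbf G_{[\mathbf a,\mathbf b]}(G)\subset\mathbf P(\mathfrak A)\subset\mathbb T^{m+n}$, then there exist an $m\times n$ matrix $\mathbf A=(A_{ij})$ and a vector $\mathbf B=(B_1;\ldots;B_n)$ such that $A_{ij}\in\mathbb Q\cap\mathbb Z_p$, $B_j\in\mathbb Q\cap\mathbb Z_p\cap[0,1)$ ($i=1,\ldots,m$; $j=1,\ldots,n$) and $G(\mathbf x)=(\mathbf x\mathbf A+\mathbf B)\bmod 1$ for all $\mathbf x\in[\mathbf a,\mathbf b]$. There are no more than finitely many $\mathbf A$ and $\mathbf B$ such that $A_{ij}\in\mathbb Q\cap\mathbb Z_p$, $B_j\in\mathbb Q\cap\mathbb Z_p\cap[0,1)$ ($i=1,\ldots,m$; $j=1,\ldots,n$) and $\mathbf G_{[\mathbf a,\mathbf b]}((\mathbf x\mathbf A+\mathbf B)\bmod1)\subset\mathbf P(\mathfrak A)$ for some $[\mathbf a,\mathbf b]\subset[0,1)^m$; moreover, if $\mathbf G_{[\mathbf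 a,\mathbf b]}(\mathbf x\mathbf A+\mathbf B)\subset\mathbf P(\mathfrak A)$ for some $[\mathbf a,\mathbf b]\subset[0,1)^m$, then $\mathbf G_{\mathbb R^m}((\mathbf x\mathbf A+\mathbf B)\bmod1)\subset\mathbf P(\mathfrak A)\subset\mathbb T^{n+m}$.
   Context: $p$ is a prime, $\mathbb F_p=\{0,1,\ldots,p-1\}$, $\mathbb N=\{1,2,\ldots\}$. $\mathbb Z_p\cap\mathbb Q$ is the set of rational numbers whose denominators in lowest terms are coprime to $p$. For $\mathbf y\in\mathbb R^k$, $\mathbf y\bmod1$ is the coordinatewise reduction $y_i\mapsto y_i-\lfloor y_i\rfloor$. For $z=\sum_{i\ge0}\alpha_ip^i\in\mathbb Z_p$ ($\alpha_i\in\mathbb F_p$), $z\bmod p^k=\sum_{i=0}^{k-1}\alpha_ip^i\in\{0,\ldots,p^k-1\}$; for $\mathbf z\in\mathbb Z_p^q$, $\frac{\mathbf z\bmod p^k}{p^k}$ is taken coordinatewise. Boxes $[\mathbf a,\mathbf b]=[a_1,b_1]\times\cdots\times[a_m,b_m]$ have $a_i<b_i$ for all $i$. An automaton with $m$ inputs and $n$ outputs over $\mathbb F_p$ is a letter-to-letter (synchronous) transducer with input alphabet $\mathbb F_p^m$, output alphabet $\mathbb F_p^n$, a set of states $\mathcal S$, a transition function $S\colon\mathbb F_p^m\times\mathcal S\to\mathcal S$, an output function $O\colon\mathbb F_p^m\times\mathcal S\to\mathbb F_p^n$ and an initial state $s_0$; all states are assumed reachable from $s_0$. It is finite if $\mathcal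 S$ is finite. Its automaton function $F_{\mathfrak A}\colon\mathbb Z_p^m\to\mathbb Z_p^n$ sends $\sum_{i\ge0}\boldsymbol\chi_ip^i$ ($\boldsymbol\chi_i\in\mathbb F_p^m$) to $\sum_{i\ge0}\boldsymbol\xi_ip^i$, where $\boldsymbol\xi_i=O(\boldsymbol\chi_i,s_i)$ and $s_{i+1}=S(\boldsymbol\chi_i,s_i)$. The plot $\mathbf P(\mathfrak A)$ is the closure in $\mathbb R^{m+n}$ of the set of all points $\left(\frac{\mathbf z\bmod p^k}{p^k};\frac{F_{\mathfrak A}(\mathbf z)\bmod p^k}{p^k}\right)\in[0,1]^{m+n}$, $\mathbf z\in\mathbb Z_p^m$, $k\in\mathbb N$; here it is considered as a subset of the torus $\mathbb T^{m+n}=\mathbb R^{m+n}/\mathbb Z^{m+n}$ by reducing coordinates modulo 1. The graph of $G\colon D\to\mathbb R^n$, $D\subset\mathbb R^m$, on the torus is $\mathbf G_D(G)=\{(\mathbf x\bmod1;G(\mathbf x)\bmod1)\colon\mathbf x\in D\}\subset\mathbb T^{m+n}$. *)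

(* Defs.v *)
From mathcomp Require Import all_boot all_order all_algebra.
From mathcomp Require Import all_classical all_reals all_analysis.

Set Implicit Arguments.
Unset Strict Implicit.
Unset Printing Implicit Defensive.

Import Order.TTheory GRing.Theory Num.Theory.
Import numFieldNormedType.Exports.

Local Open Scope classical_set_scope.
Local Open Scope ring_scope.

(* The alphabet F_p^k, with F_p identified with the digits {0, ..., p-1}. *)
Definition letter (p k : nat) := {ffun 'I_k -> 'I_p}.

(* Z_p^k, a point \sum_i chi_i p^i being given by its sequence of digit
   vectors chi_i. *)
Definition padic_vec (p k : nat) := nat -> letter p k.

Record automaton (p m n : nat) := Automaton {
  state : Type;
  trans : letter p m -> state -> state;
  output : letter p m -> state -> letter p n;
  init : state;
  state_reachable : forall s : state,
    exists w : seq (letter p m), foldl (fun t c => trans c t) init w = s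
}.

Definition finite_automaton (p m n : nat) (A : automaton p m n) : Prop :=
  finite_set [set: state A].

Fixpoint state_at (p m n : nat) (A : automaton p m n) (z : padic_vec p m)
    (i : nat) : state A :=
  if i is j.+1 then trans (z j) (state_at A z j) else init A.

Definition automaton_fun (p m n : nat) (A : automaton p m n)
    (z : padic_vec p m) : padic_vec p n :=
  fun i => output (z i) (state_at A z i).

Definition trunc_frac (R : realType) (p q : nat) (z : padic_vec p q)
    (k : nat) : 'rV[R]_q :=
  \row_i ((\sum_(l < k) z l i * p ^ l)%N%:R / (p ^ k)%N%:R).
Arguments trunc_frac R {p q} z k.

Definition mod1 (R : realType) (k : nat) (y : 'rV[R]_k) : 'rV[R]_k :=
  map_mx (fun t : R => t - (Num.floor t)%:~R) y.

Definition plot (R : realType) (p m n : nat) (A : automaton p m n) :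
    set 'rV[R]_(m + n) :=
  closure [set v | exists (z : padic_vec p m) (k : nat), (0 < k)%N /\
    v = row_mx (trunc_frac R z k) (trunc_frac R (automaton_fun A z) k)].
Arguments plot R {p m n} A.

(* Subsets of the torus R^k / Z^k are represented by subsets of its fundamental
   domain [0, 1)^k. *)
Definition torus_plot (R : realType) (p m n : nat) (A : automaton p m n) :
    set 'rV[R]_(m + n) :=
  @mod1 R (m + n) @` plot R A.
Arguments torus_plot R {p m n} A.

Definition torus_graph (R : realType) (m n : nat) (D : set 'rV[R]_m)
    (G : 'rV[R]_m -> 'rV[R]_n) : set 'rV[R]_(m + n) :=
  [set row_mx (mod1 x) (mod1 (G x)) | x in D].

Definition box (R : realType) (m : nat) (a b : 'rV[R]_m) : set 'rV[R]_m :=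
  [set x | forall i, a 0 i <= x 0 i <= b 0 i].

Definition unit_box (R : realType) (m : nat) (a b : 'rV[R]_m) : Prop :=
  forall i, [/\ 0 <= a 0 i, a 0 i < b 0 i & b 0 i < 1].

(* The column vector v is the gradient at x of f restricted to D. On a box with
   nonempty interior v is unique; differentiability at boundary points only
   involves the values of f on the box. *)
Definition gradient_within (R : realType) (m : nat) (D : set 'rV[R]_m)
    (f : 'rV[R]_m -> R) (x : 'rV[R]_m) (v : 'cV[R]_m) : Prop :=
  forall e : R, 0 < e -> \forall y \near within D (nbhs x),
    `|f y - f x - ((y - x) *m v) 0 0| <= e * `|y - x|.

(* H x j i is the second partial derivative d_j d_i f at x. *)
Definition C2_on (R : realType) (m : nat) (D : set 'rV[R]_m)
    (f : 'rV[R]_m -> R) : Prop :=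
  exists (g : 'rV[R]_m -> 'cV[R]_m) (H : 'rV[R]_m -> 'M[R]_m),
  [/\ forall x, D x -> gradient_within D f x (g x),
      forall i x, D x ->
        gradient_within D (fun y => g y i 0) x (col i (H x)) &
      forall j i, {within D, continuous (fun x => H x j i)}].

Definition rat_in_Zp (p : nat) (r : rat) : bool := coprime p `|denq r|%N.

Definition admissible (p m n : nat) (A : 'M[rat]_(m, n)) (B : 'rV[rat]_n) :
    Prop :=
  (forall i j, rat_in_Zp p (A i j)) /\
  (forall j, rat_in_Zp p (B 0 j) && (0 <= B 0 j < 1)).

Definition affine_map (R : realType) (m n : nat) (A : 'M[rat]_(m, n))
    (B : 'rV[rat]_n) (x : 'rV[R]_m) : 'rV[R]_n :=
  x *m map_mx ratr A + map_mx ratr B.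

(* Main.v *)
Require Import Defs.
From mathcomp Require Import all_boot all_order all_algebra.
From mathcomp Require Import all_classical all_reals all_analysis.
From mathcomp Require Import cyclic zify ring lra.

(** Only one property of a finite automaton is used: it has finitely many
    states, say N.  Read a point (x, y) of the plot through its k most
    significant digits in base p.  The k leading digits of x are the last k
    letters read, starting from some state s, and the k leading digits of y are
    what the automaton writes meanwhile.  Its output is causal, so the j
    low-order digits of this output block are determined by s and by the j
    low-order digits of the input block ([window_read]).  Among N + 1 points
    whose input blocks agree in their low-order digits, two share the state s,
    and so their output blocks agree in the corresponding low-order digits
    ([ex_pigeonhole_bound]).  Every arithmetic conclusion comes from feeding
    well-chosen families of N + 1 points of a graph to this pigeonhole.

    Slopes.  Let G be differentiable at x0, with graph in the plot, and let v be
    a partial derivative of a coordinate of G there.  At a scale p^k so fine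
    that G is affine up to an error well below p^-k, take points near x0 whose
    input blocks, in one coordinate, are U + p^J (1 + p + ... + p^(t-1)) for
    t = 0, ..., N.  The pigeonhole says that (1 + p + ... + p^(r-1)) v is within
    6 / p^J of an integer for some r between 1 and N.  As J is arbitrary, the
    product D of all these repunits satisfies D v in Z ([slope_denom_clears]);
    it depends on N only and is coprime to p, since each repunit is 1 modulo p.
    If G is C^2, its gradient is continuous with values in a discrete set, hence
    constant on the box, and G is affine ([int_gradient_affine]).

    Intercepts.  For an affine graph x A + B over a cylinder of depth k0 with
    leading digits h, take the points whose input blocks repeat h more and more
    often in front of J zeros.  Their lengths k now differ, and the pigeonhole
    compares p^k B for two values of k: up to integers and a multiple of A, it
    makes (p^(k0 r) - 1) B arbitrarily close to Z / D, so B too is rational with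
    denominator coprime to p ([intercept_denom_clears]).

    From a box to all of R^m.  If E is coprime to p and clears the denominators
    of A and B, choose l with p^l = 1 modulo E.  Multiplication by p^l drops the
    last l letters of the words, so it preserves the plot modulo 1; it fixes the
    affine torus map, and it stretches any box over a full period
    ([affine_spread]).

    Finiteness.  Over the whole space one may take k0 = 1 and h = 0, so all
    denominators divide one integer depending on N and p only, and a steep plane
    would meet too many different output blocks above one input block
    ([slope_bound]).  Only finitely many matrices and vectors remain.

    The proof works with the closure of the word points and all their integer
    translates ([lifted_plot]), which is the preimage in R^(m+n) of the plot in
    the torus and is not affected by the discontinuity of reduction modulo 1. *)

Set Implicit Arguments.
Unset Strict Implicit.
Unset Printing Implicit Defensive.

Import Order.TTheory GRing.Theory Num.Theory.
Import numFieldNormedType.Exports.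

Local Open Scope classical_set_scope.
Local Open Scope ring_scope.

(** * Digits of words and runs of the automaton *)

Definition numeral (p q : nat) (z : padic_vec p q) (k : nat) (i : 'I_q) : nat :=
  (\sum_(l < k) z l i * p ^ l)%N.

Definition drop_digits (p q : nat) (a : nat) (z : padic_vec p q) : padic_vec p q :=
  fun l => z (a + l)%N.

Lemma numeral_cat (p q : nat) (z : padic_vec p q) (a k : nat) (i : 'I_q) :
  numeral z (a + k) i = (numeral z a i + p ^ a * numeral (drop_digits a z) k i)%N.
Proof.
rewrite /numeral big_split_ord /=; congr addn.
by rewrite big_distrr /=; apply: eq_bigr => l _; rewrite /drop_digits expnD; lia.
Qed.

Lemma numeral_recr (p q : nat) (z : padic_vec p q) (k : nat) (i : 'I_q) :
  numeral z k.+1 i = (numeral z k i + z k i * p ^ k)%N.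
Proof. by rewrite /numeral big_ord_recr. Qed.

Lemma numeral_lt (p q : nat) (z : padic_vec p q) (k : nat) (i : 'I_q) :
  (numeral z k i < p ^ k)%N.
Proof.
elim: k => [|k IH]; first by rewrite /numeral big_ord0 expn0.
rewrite numeral_recr expnS.
by have := ltn_ord (z k i); nia.
Qed.

Lemma numeral_modn (p q : nat) (z : padic_vec p q) (j k : nat) (i : 'I_q) :
  (j <= k)%N -> (numeral z k i = numeral z j i %[mod p ^ j])%N.
Proof.
move=> /subnKC <-; rewrite numeral_cat.
by rewrite addnC mulnC modnMDl.
Qed.

Lemma numeral_inj (p q : nat) (z z' : padic_vec p q) (k : nat) :
  (forall i, numeral z k i = numeral z' k i) ->
  forall l, (l < k)%N -> z l = z' l.
Proof.
elim: k => [//|k IH] zz' l.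
have E i : numeral z k i = numeral z' k i /\ z k i = z' k i.
  have := zz' i; rewrite !numeral_recr.
  have := numeral_lt z k i; have := numeral_lt z' k i.
  move=> h1 h2 h3.
  have h4 : nat_of_ord (z k i) = z' k i by nia.
  by split; [lia | exact: val_inj].
rewrite ltnS leq_eqVlt => /orP[/eqP ->|]; last by apply: IH => i; case: (E i).
by apply/ffunP => i; case: (E i).
Qed.

Section Run.
Variables (p m n : nat) (Aut : automaton p m n).

Fixpoint state_from (s : state Aut) (z : padic_vec p m) (i : nat) : state Aut :=
  if i is j.+1 then trans (z j) (state_from s z j) else s.

Definition output_from (s : state Aut) (z : padic_vec p m) : padic_vec p n :=
  fun i => output (z i) (state_from s z i).

Lemma drop_automaton_fun (z : padic_vec p m) (a : nat) :
  drop_digits a (automaton_fun Aut z) = output_from (state_at Aut z a) (drop_digits a z).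
Proof.
have E l : state_at Aut z (a + l) = state_from (state_at Aut z a) (drop_digits a z) l.
  by elim: l => [|l IH]; rewrite ?addn0 // addnS /= IH.
by apply/funext => l; rewrite /drop_digits /automaton_fun /output_from E.
Qed.

(** Causality: the first k output letters depend on the first k input letters
    and on the starting state only. *)
Lemma numeral_output_from (s : state Aut) (z z' : padic_vec p m) (k : nat) j :
  (forall i, numeral z k i = numeral z' k i) ->
  numeral (output_from s z) k j = numeral (output_from s z') k j.
Proof.
move=> /(@numeral_inj _ _ z z' k) zz'.
have E l : (l <= k)%N -> state_from s z l = state_from s z' l.
  by elim: l => [//|l IH] lk /=; rewrite IH 1?ltnW // zz'.
by apply: eq_bigr => l _; rewrite /output_from E 1?ltnW // zz'.
Qed.

End Run.

(** * The periodic plot and the reading of a window *)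

Definition word_point (R : realType) (p m n : nat) (Aut : automaton p m n)
    (z : padic_vec p m) (k : nat) : 'rV[R]_(m + n) :=
  row_mx (trunc_frac R z k) (trunc_frac R (automaton_fun Aut z) k).
Arguments word_point R {p m n} Aut z k.

(** The closure of the set of all integer translates of word points.  Integer
    parts are chosen coordinate by coordinate, which avoids integer vectors. *)
Definition lifted_plot (R : realType) (p m n : nat) (Aut : automaton p m n) :
    set 'rV[R]_(m + n) :=
  [set v | forall e : R, 0 < e -> exists (z : padic_vec p m) (k : nat),
    (0 < k)%N /\
    forall i, exists w : int, `|v 0 i - w%:~R - word_point R Aut z k 0 i| < e].
Arguments lifted_plot R {p m n} Aut.

Lemma trunc_fracE (R : realType) (p q : nat) (z : padic_vec p q) k i :
  trunc_frac R z k 0 i = (numeral z k i)%:R / p%:R ^+ k.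
Proof. by rewrite mxE -natrX. Qed.

(** When x lies strictly inside the cylinder of the block U, a word whose point is
    close to (x, y) modulo 1 is longer than k, because shorter words give
    points of the lattice p^-k Z^m; its last k letters then spell U modulo p^k
    and are read from the state s reached before them.  The bound 2 is not
    sharp: the letters read before the window contribute less than 1, and so
    does the approximation. *)
Lemma window_read (R : realType) (p m n : nat) (Aut : automaton p m n)
    (x : 'rV[R]_m) (y : 'rV[R]_n) (k : nat) (U : 'I_m -> int) :
  (0 < p)%N -> (0 < m)%N -> lifted_plot R Aut (row_mx x y) ->
  (forall i, (U i)%:~R < p%:R ^+ k * x 0 i < (U i)%:~R + 1) ->
  exists (s : state Aut) (z : padic_vec p m),
    (forall i, exists w : int, U i = (numeral z k i)%:Z + (p ^ k)%:Z * w) /\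
    (forall j, exists w : int, `|p%:R ^+ k * y 0 j -
      (numeral (output_from s z) k j)%:R - p%:R ^+ k * w%:~R| <= 2).
Proof.
move=> p0 m0 Q xU.
set P : R := p%:R.
have Pgt0 a : 0 < P ^+ a by rewrite exprn_gt0 // ltr0n.
(* d is half the distance from p^k x to the walls of its unit cell, capped at 1. *)
have [d [d0 d1 xd]] : exists d : R, [/\ 0 < d, d <= 1 &
    forall i, (U i)%:~R + d < P ^+ k * x 0 i < (U i)%:~R + 1 - d].
  pose f i := Num.min (P ^+ k * x 0 i - (U i)%:~R)
                      ((U i)%:~R + 1 - P ^+ k * x 0 i) / 2.
  have f0 i : 0 < f i.
    have /andP[h1 h2] := xU i; rewrite divr_gt0 // lt_min !subr_gt0.
    by rewrite h1.
  exists (\big[Num.min/1]_i f i); split.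
  - by apply: lt_bigmin => // i _; exact: f0.
  - exact: bigmin_le_id.
  - move=> i; have := f0 i; have : \big[Num.min/1]_i f i <= f i by apply: bigmin_le.
    rewrite /f; set M := Num.min _ _ => h1 h2.
    have h3 : M <= P ^+ k * x 0 i - (U i)%:~R by rewrite ge_min lexx.
    have h4 : M <= (U i)%:~R + 1 - P ^+ k * x 0 i by rewrite ge_min lexx orbT.
    by apply/andP; split; lra.
have [z [K [K0 zK]]] := Q (d / P ^+ k) (divr_gt0 d0 (Pgt0 k)).
have scale (t : R) : `|t| < d / P ^+ k -> `|P ^+ k * t| < d.
  by rewrite normrM (gtr0_norm (Pgt0 k)) ltr_pdivlMr // mulrC.
have xw i : exists w : int,
    `|P ^+ k * x 0 i - P ^+ k * w%:~R - P ^+ k * ((numeral z K i)%:R / P ^+ K)| < d.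
  have [w] := zK (lshift n i) => p1; exists w.
  by rewrite -!mulrBr; apply: scale; move: p1; rewrite /word_point !row_mxEl trunc_fracE.
have yw j : exists w : int,
    `|P ^+ k * y 0 j - P ^+ k * w%:~R -
      P ^+ k * ((numeral (automaton_fun Aut z) K j)%:R / P ^+ K)| < d.
  have [w] := zK (rshift m j) => p1; exists w.
  by rewrite -!mulrBr; apply: scale; move: p1; rewrite /word_point !row_mxEr trunc_fracE.
have kK : (k < K)%N.
  rewrite ltnNge; apply/negP => Kk.
  pose i0 := Ordinal m0.
  have [w] := xw i0; have /andP[h1 h2] := xd i0.
  have -> : P ^+ k * ((numeral z K i0)%:R / P ^+ K) =
            ((p ^ (k - K) * numeral z K i0)%N : int)%:~R :> R.
    rewrite -[in P ^+ k](subnK Kk) exprD -pmulrn natrM natrX -/P.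
    by field; rewrite gt_eqF.
  rewrite -[P ^+ k * w%:~R](_ : (((p ^ k)%:Z * w)%:~R : R) = _); last first.
    by rewrite intrM -pmulrn natrX.
  rewrite -addrA -opprD -intrD; set a := (X in _ - X%:~R) => /ltr_normlP[h3 h4].
  have : (U i0)%:~R < a%:~R :> R by lra.
  have : a%:~R < (U i0 + 1)%:~R :> R by rewrite intrD; lra.
  rewrite !ltr_int; lia.
pose a := (K - k)%N; have Kak : K = (a + k)%N by rewrite subnK // ltnW.
(* The last k letters of the word give the integer part of p^k times its value. *)
have split_num q (y' : padic_vec p q) j :
    P ^+ k * ((numeral y' K j)%:R / P ^+ K) =
    (numeral (drop_digits a y') k j)%:R + (numeral y' a j)%:R / P ^+ a.
  rewrite Kak numeral_cat natrD natrM natrX -/P exprD.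
  by field; rewrite !gt_eqF.
have frac_num q (y' : padic_vec p q) j : 0 <= ((numeral y' a j)%:R / P ^+ a : R) < 1.
  rewrite divr_ge0 ?(ltW (Pgt0 a)) //= ltr_pdivrMr // mul1r -natrX ltr_nat.
  exact: numeral_lt.
exists (state_at Aut z a), (drop_digits a z); split.
  move=> i; have [w] := xw i; rewrite split_num => p1; exists w.
  have /andP[h1 h2] := xd i; have /andP[h3 h4] := frac_num _ z i.
  move: p1; rewrite -[P ^+ k * w%:~R](_ : (((p ^ k)%:Z * w)%:~R : R) = _); last first.
    by rewrite intrM -pmulrn natrX.
  move=> /ltr_normlP[h5 h6].
  set v := numeral _ k i in h5 h6 *.
  have h7 : (U i)%:~R < (v%:Z + (p ^ k)%:Z * w + 1)%:~R :> R.
    by rewrite !intrD -pmulrn; lra.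
  have h8 : (v%:Z + (p ^ k)%:Z * w)%:~R < (U i + 1)%:~R :> R.
    by rewrite !intrD -pmulrn; lra.
  move: h7 h8; rewrite !ltr_int; lia.
move=> j; have [w] := yw j; rewrite split_num drop_automaton_fun => p1; exists w.
have /andP[h3 h4] := frac_num _ (automaton_fun Aut z) j.
move: p1 => /ltr_normlP[h5 h6]; apply/ler_normlP; split; lra.
Qed.

(** * The pigeonhole on states *)

Definition near_int (R : realType) (e t : R) : Prop :=
  exists w : int, `|t - w%:~R| <= e.

Lemma near_intW (R : realType) (e e' t : R) :
  e <= e' -> near_int e t -> near_int e' t.
Proof. by move=> ee' [w tw]; exists w; apply: le_trans ee'. Qed.

Lemma near_intM (R : realType) (e t : R) (c : nat) :
  near_int e t -> near_int (c%:R * e) (c%:R * t).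
Proof.
move=> [w tw]; exists (c%:Z * w); rewrite intrM -pmulrn -mulrBr normrM.
by rewrite normr_nat ler_wpM2l.
Qed.

Lemma expn_unbounded (R : realType) (p : nat) (x : R) :
  (1 < p)%N -> exists k0 : nat, forall k, (k0 <= k)%N -> x < p%:R ^+ k.
Proof.
move=> p1; exists (Num.trunc x).+1 => k kx.
have h : x < (Num.trunc x).+1%:R.
  have [x0|x0] := leP 0 x; first exact: truncnS_gt.
  by rewrite (lt_le_trans x0).
rewrite (lt_trans h) // -natrX ltr_nat (leq_ltn_trans kx) //.
exact: ltn_expl.
Qed.

Lemma near_int_integral (R : realType) (p : nat) (C t : R) : (1 < p)%N ->
  (forall J, near_int (C / p%:R ^+ J) t) -> exists w : int, t = w%:~R.
Proof.
move=> p1 h; exists (Num.floor t); apply/eqP; rewrite eq_le floor_le andbT.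
rewrite leNgt; apply/negP => ft.
have := floorD1_gt t; rewrite intrD => tf.
pose e := Num.min (t - (Num.floor t)%:~R) ((Num.floor t)%:~R + 1 - t).
have e0 : 0 < e by rewrite lt_min !subr_gt0 ft.
have [J0 /(_ J0 (leqnn _))] := @expn_unbounded R p (C / e) p1.
set q : R := p%:R ^+ J0 => CJ.
have q0 : 0 < q by rewrite exprn_gt0 // ltr0n ltnW.
have [w] := h J0; rewrite -/q => tw.
have /(le_lt_trans tw) : C / q < e by rewrite ltr_pdivrMr // mulrC -ltr_pdivrMr.
rewrite lt_min => /andP[/ltr_normlP[h1 h2] /ltr_normlP[h3 h4]].
have : (Num.floor t)%:~R < w%:~R :> R by lra.
have : w%:~R < (Num.floor t + 1)%:~R :> R by rewrite intrD; lra.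
by rewrite !ltr_int ltzD1 => wf /lt_le_trans-/(_ _ wf); rewrite ltxx.
Qed.

Lemma finite_automaton_card (p m n : nat) (Aut : automaton p m n) :
  finite_automaton Aut -> exists (N : nat) (f : state Aut -> nat),
    (forall s, (f s < N)%N) /\ injective f.
Proof.
move=> [N /card_set_bijP[f [f1 f2 _]]]; exists N, f; split.
  by move=> s; exact: f1.
by move=> s t; apply: f2; rewrite inE.
Qed.

Lemma eqn_mod_int (q a b : nat) (c : int) :
  b%:Z = a%:Z + q%:Z * c -> (a = b %[mod q])%N.
Proof.
case: c => c bac.
  have -> : b = (c * q + a)%N by nia.
  by rewrite modnMDl.
have -> : a = (c.+1 * q + b)%N by nia.
by rewrite modnMDl.
Qed.

(** For N + 1 points of the periodic plot seen through windows of lengths k a, two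
    output blocks agree, up to a bounded error, modulo p^(J a), as soon as the
    input blocks are pairwise congruent modulo p^(J a).  Quantifying over the
    scales k and J separately serves all the families of points used below: a
    fixed scale for slopes, growing scales for intercepts. *)
Definition pigeonhole_bound (R : realType) (p m n : nat)
    (Aut : automaton p m n) (N : nat) : Prop :=
  forall (k J : nat -> nat) (U : nat -> 'I_m -> int)
      (x : nat -> 'rV[R]_m) (y : nat -> 'rV[R]_n),
    (forall a, (a <= N)%N -> lifted_plot R Aut (row_mx (x a) (y a))) ->
    (forall a i, (a <= N)%N ->
       (U a i)%:~R < p%:R ^+ k a * x a 0 i < (U a i)%:~R + 1) ->
    (forall a b, (a < b <= N)%N -> [/\ (J a <= k a)%N, (J a <= k b)%N &
       forall i, exists w : int, U b i = U a i + (p ^ J a)%:Z * w]) ->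
    exists a b, (a < b <= N)%N /\
      forall j, near_int (4 / p%:R ^+ J a)
        ((p%:R ^+ k b * y b 0 j - p%:R ^+ k a * y a 0 j) / p%:R ^+ J a).
Arguments pigeonhole_bound R {p m n} Aut N.

Lemma ex_pigeonhole_bound (R : realType) (p m n : nat) (Aut : automaton p m n) :
  (1 < p)%N -> (0 < m)%N -> finite_automaton Aut ->
  exists N : nat, pigeonhole_bound R Aut N.
Proof.
move=> p1 m0 /finite_automaton_card[N [f [fN finj]]]; exists N.
move=> k J U x y Q xU UJ.
set P : R := p%:R.
have Pgt0 a : 0 < P ^+ a by rewrite exprn_gt0 // ltr0n ltnW.
have rd a : exists s : state Aut, (a <= N)%N -> exists z : padic_vec p m,
    (forall i, exists w : int, U a i = (numeral z (k a) i)%:Z + (p ^ k a)%:Z * w) /\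
    (forall j, exists w : int, `|P ^+ k a * y a 0 j -
      (numeral (output_from s z) (k a) j)%:R - P ^+ k a * w%:~R| <= 2).
  have [aN|aN] := leqP a N; last by exists (init Aut).
  have [s [z zP]] := window_read (ltnW p1) m0 (Q a aN) (fun i => xU a i aN).
  by exists s => _; exists z.
have {rd} [s sP] := choice rd.
have [a [b [/andP[ab bN] sab]]] : exists a b, (a < b <= N)%N /\ s a = s b.
  apply: contrapT => ns.
  suff: (N.+1 <= N)%N by rewrite ltnn.
  apply: (@pigeonhole _ _ (f \o s)); last first.
    by move=> _ [a _ <-] /=; exact: fN.
  move=> a b; rewrite !inE /= !ltnS => aN bN /finj sab.
  apply/eqP; case: ltngtP => // lt; exfalso; apply: ns.
    by exists a, b; rewrite lt bN.
  by exists b, a; rewrite lt aN.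
have [Ja Jb UU] := UJ a b (introT andP (conj ab bN)).
exists a, b; split; first by rewrite ab.
have [z [zU zy]] := sP a (leq_trans (ltnW ab) bN).
have [z' [zU' zy']] := sP b bN.
(* Both runs start in the same state and read the same J a low-order digits,
   so their outputs share these digits too. *)
have low i : numeral z (J a) i = numeral z' (J a) i.
  have [w1 h1] := zU i; have [w2 h2] := zU' i; have [w h] := UU i.
  have h3 := numeral_modn z i Ja; have h4 := numeral_modn z' i Jb.
  have h5 := numeral_lt z (J a) i; have h6 := numeral_lt z' (J a) i.
  have [c hc] : exists c : int, (numeral z' (k b) i)%:Z =
      (numeral z (k a) i)%:Z + (p ^ J a)%:Z * c.
    exists (w + (p ^ (k a - J a))%:Z * w1 - (p ^ (k b - J a))%:Z * w2).
    have qa : (p ^ k a)%:Z = (p ^ J a)%:Z * (p ^ (k a - J a))%:Z.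
      by rewrite -PoszM -expnD subnKC.
    have qb : (p ^ k b)%:Z = (p ^ J a)%:Z * (p ^ (k b - J a))%:Z.
      by rewrite -PoszM -expnD subnKC.
    rewrite -[LHS](addrK ((p ^ k b)%:Z * w2)) -h2 h h1 qa qb; ring.
  have : (numeral z (k a) i = numeral z' (k b) i %[mod p ^ J a])%N.
    exact: eqn_mod_int hc.
  by rewrite h3 h4 !modn_small.
move=> j; have [w wy] := zy j; have [w' wy'] := zy' j.
have E := numeral_output_from (s a) j low; rewrite sab in E wy.
have [ca kaE] : exists c, k a = (J a + c)%N by exists (k a - J a)%N; rewrite subnKC.
have [cb kbE] : exists c, k b = (J a + c)%N by exists (k b - J a)%N; rewrite subnKC.
rewrite {}kaE {}kbE !numeral_cat {}E !exprD !natrD !natrM natrX -/P in wy wy' *.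
move: wy wy'; set q := P ^+ J a; set r := (numeral _ (J a) j)%:R.
set A := (numeral _ ca j); set B := (numeral _ cb j) => wy wy'.
exists (B%:Z - A%:Z + (p ^ cb)%:Z * w' - (p ^ ca)%:Z * w).
have q0 : 0 < q by apply: Pgt0.
rewrite intrB intrD intrB !intrM -!pmulrn !natrX -/P.
rewrite ler_pdivlMr // -[X in _ * X <= _](gtr0_norm q0) -normrM mulrBl divfK ?gt_eqF //.
move: wy wy' => /ler_normlP[h1 h2] /ler_normlP[h3 h4].
by apply/ler_normlP; split; lra.
Qed.

(** * Slopes *)

Definition repunit (q t : nat) : nat := (\sum_(l < t) q ^ l)%N.

Lemma repunitD (q a b : nat) : repunit q (a + b) = (repunit q a + q ^ a * repunit q b)%N.
Proof.
rewrite /repunit big_split_ord big_distrr /=; congr addn.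
by apply: eq_bigr => l _; rewrite expnD.
Qed.

Lemma repunitS (q t : nat) : repunit q t.+1 = (1 + q * repunit q t)%N.
Proof. by rewrite -add1n repunitD /repunit big_ord1 expn0 expn1. Qed.

Lemma coprime_repunit (q t : nat) : coprime q (repunit q t.+1).
Proof. by rewrite repunitS /coprime addnC mulnC gcdnMDl gcdn1. Qed.

Definition slope_denom (p N : nat) : nat := (\prod_(t < N) repunit p t.+1)%N.

Lemma coprime_slope_denom (p N : nat) : coprime p (slope_denom p N).
Proof.
rewrite /slope_denom; elim/big_ind: _ => [|a b|t _]; first exact: coprimen1.
  by rewrite coprimeMr => -> ->.
exact: coprime_repunit.
Qed.

Lemma repunit_dvd_slope_denom (p N t : nat) :
  (0 < t <= N)%N -> (repunit p t %| slope_denom p N)%N.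
Proof.
case: t => [//|t] tN; rewrite /slope_denom (bigD1 (Ordinal tN)) //=.
exact: dvdn_mulr.
Qed.

(** A box contains, close to any of its points x0, and even when x0 is on the
    boundary, a stretch of the lattice of mesh 1 / q of prescribed length C: move
    from x0 towards the farther face. *)
Lemma lattice_room (R : realType) (a b x0 q : R) (C : nat) :
  0 < q -> 2 * (C%:R + 3) <= q * (b - a) -> a <= x0 <= b ->
  exists U : int, forall t, 0 <= t <= C%:R + 1 ->
    a <= (U%:~R + t) / q <= b /\ `|(U%:~R + t) / q - x0| <= (C%:R + 3) / q.
Proof.
move=> q0 room /andP[ax xb].
have C0 : 0 <= C%:R :> R by [].
have qax : q * a <= q * x0 by rewrite ler_pM2l.
have qxb : q * x0 <= q * b by rewrite ler_pM2l.
have ff := floor_le (q * x0); have := floorD1_gt (q * x0); rewrite intrD => fg.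
have main (V : R) : q * a <= V <= q * b -> `|V - q * x0| <= C%:R + 3 ->
    a <= V / q <= b /\ `|V / q - x0| <= (C%:R + 3) / q.
  move=> /andP[h1 h2] h3; rewrite ler_pdivlMr // ler_pdivrMr //.
  split; first by rewrite mulrC h1 mulrC.
  rewrite ler_pdivlMr // -[X in _ * X <= _](gtr0_norm q0) -normrM mulrBl.
  by rewrite divfK ?gt_eqF // (mulrC x0).
have [left|right] := leP (2 * (q * x0)) (q * a + q * b).
  exists (Num.floor (q * x0) + 1) => t /andP[t0 tC]; apply: main.
    by rewrite intrD; apply/andP; split; lra.
  by rewrite intrD; apply/ler_normlP; split; lra.
exists (Num.floor (q * x0) - (C%:Z + 1)) => t /andP[t0 tC]; apply: main.
  by rewrite intrB intrD -pmulrn; apply/andP; split; lra.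
by rewrite intrB intrD -pmulrn; apply/ler_normlP; split; lra.
Qed.

Lemma row_normP (R : realType) (m : nat) (x : 'rV[R]_m) (e : R) :
  0 <= e -> reflect (forall i, `|x 0 i| <= e) (`|x| <= e).
Proof.
move=> e0; have -> : `|x| = mx_norm x by []; rewrite mx_normrE; apply: (iffP idP) => [h i|h].
  by apply: le_trans h; apply: (le_bigmax _ (fun ij => `|x ij.1 ij.2|) (0, i)).
by apply/bigmax_leP; split => // -[i j] _ /=; rewrite ord1.
Qed.

Lemma gradient_withinP (R : realType) (m : nat) (D : set 'rV[R]_m) f x v (e : R) :
  gradient_within D f x v -> 0 < e -> exists2 d, 0 < d & forall y, D y ->
    `|y - x| < d -> `|f y - f x - ((y - x) *m v) 0 0| <= e * `|y - x|.
Proof.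
move=> /[apply]; rewrite near_withinE => /nbhs_ballP[d /= d0 h]; exists d => //.
by move=> y Dy yx; apply: h => //; rewrite mx_norm_ball /ball_ /= distrC.
Qed.

(** The N + 1 points have input blocks U0 + p^J repunit(t) in the coordinate i.
    Two such blocks, for s < t, differ by p^(J+s) repunit(t - s): they are
    congruent modulo p^(J+s), and the quotient of the difference is a repunit
    whatever s and t are. *)
Lemma slope_denom_clears (R : realType) (p m n : nat) (Aut : automaton p m n)
    (N : nat) (a b x0 : 'rV[R]_m) (G : 'rV[R]_m -> 'rV[R]_n) (j : 'I_n)
    (v : 'cV[R]_m) (i : 'I_m) :
  (1 < p)%N -> pigeonhole_bound R Aut N -> (forall c, a 0 c < b 0 c) ->
  (forall x, box a b x -> lifted_plot R Aut (row_mx x (G x))) ->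
  box a b x0 -> gradient_within (box a b) (fun x => G x 0 j) x0 v ->
  exists w : int, (slope_denom p N)%:R * v i 0 = w%:~R.
Proof.
move=> p1 HN ab GQ x0ab Gv.
apply: (@near_int_integral _ _ ((slope_denom p N)%:R * 6) _ p1) => J.
set P : R := p%:R.
have Pgt0 c : 0 < P ^+ c by rewrite exprn_gt0 // ltr0n ltnW.
(* The blocks below stay within M + 1 of U0. *)
pose M := (p ^ J * repunit p N)%N.
have M3 : 0 < M%:R + 3 :> R by rewrite ltr_wpDl.
have [d d0 Gd] := gradient_withinP Gv (divr_gt0 ltr01 M3).
have [k [kJ kd kab]] : exists k, [/\ (J + N <= k)%N, (M%:R + 3) / d < P ^+ k &
    forall c, 2 * (M%:R + 3) / (b 0 c - a 0 c) < P ^+ k].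
  have [k1 k1P] := @expn_unbounded R p ((M%:R + 3) / d) p1.
  have /choice[k2 k2P] :=
    fun c => @expn_unbounded R p (2 * (M%:R + 3) / (b 0 c - a 0 c)) p1.
  exists (J + N + (k1 + \max_c k2 c))%N; split; first exact: leq_addr.
    by apply: k1P; lia.
  by move=> c; apply: k2P; have := leq_bigmax (F := k2) c; lia.
have /choice[U0 U0P] : forall c : 'I_m, exists U : int, forall t, 0 <= t <= M%:R + 1 ->
    a 0 c <= (U%:~R + t) / P ^+ k <= b 0 c /\
    `|(U%:~R + t) / P ^+ k - x0 0 c| <= (M%:R + 3) / P ^+ k.
  move=> c; apply: lattice_room => //.
  by rewrite -ler_pdivrMr ?subr_gt0 // ltW.
pose U t c : int := U0 c + (if c == i then p ^ J * repunit p t else 0)%N%:Z.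
pose x t : 'rV[R]_m := \row_c (((U t c)%:~R + 1 / 2) / P ^+ k).
have xP t c : (t <= N)%N -> a 0 c <= x t 0 c <= b 0 c /\
    `|x t 0 c - x0 0 c| <= (M%:R + 3) / P ^+ k.
  move=> tN; rewrite mxE /U intrD -pmulrn -addrA; apply: U0P.
  have : (if c == i then p ^ J * repunit p t else 0)%N%:R <= M%:R :> R.
    rewrite ler_nat; case: ifP => // _; rewrite leq_mul2l -(subnKC tN) repunitD.
    by rewrite leq_addr orbT.
  set X := _%:R; have : 0 <= X by []; lra.
have xab t : (t <= N)%N -> box a b (x t) by move=> tN c; case: (xP t c tN).
have xx0 t : (t <= N)%N -> `|x t - x0| <= (M%:R + 3) / P ^+ k.
  move=> tN; apply/row_normP => [|c]; first by rewrite divr_ge0 // ltW.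
  by rewrite !mxE; have [_] := xP t c tN; rewrite mxE.
(* The tolerance 1 / (M + 3) turns the distance (M + 3) / p^k from x0 into an
   error of at most p^-k in the affine approximation. *)
have Gx t : (t <= N)%N ->
    `|P ^+ k * (G (x t) 0 j - G x0 0 j - ((x t - x0) *m v) 0 0)| <= 1.
  move=> tN; rewrite normrM (gtr0_norm (Pgt0 k)) mulrC -ler_pdivlMr //.
  have := Gd (x t) (xab t tN); have := xx0 t tN => h1 h2.
  have h3 : `|x t - x0| < d.
    by apply: le_lt_trans h1 _; rewrite ltr_pdivrMr // mulrC -ltr_pdivrMr.
  apply: le_trans (h2 h3) _; rewrite mul1r ler_pdivrMl //.
  by rewrite mul1r.
have [||s [t [/andP[st tN] /(_ j) [w]]]] := HN (fun=> k) (fun t => J + t)%N U x (G \o x)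
  (fun t tN => GQ _ (xab t tN)).
- move=> t c tN; rewrite mxE (mulrC (P ^+ k)) divfK ?gt_eqF ?Pgt0 //; apply/andP; split; lra.
- move=> s t /andP[st tN]; split; [lia | lia | move=> c].
  rewrite /U -(subnKC (ltnW st)) repunitD; case: ifP => _; last by exists 0; rewrite mulr0 !addr0.
  by exists (repunit p (t - s))%:Z; rewrite expnD mulnDr PoszD addrA mulnA PoszM.
have sN : (s <= N)%N by rewrite (leq_trans (ltnW st)).
have q0 := Pgt0 (J + s)%N; rewrite /= -/P; set q := P ^+ (J + s) in q0 *.
set r := repunit p (t - s).
have diff : P ^+ k * (((x t - x0) *m v) 0 0 - ((x s - x0) *m v) 0 0) = q * (r%:R * v i 0).
  have -> : ((x t - x0) *m v) 0 0 - ((x s - x0) *m v) 0 0 = ((x t - x s) *m v) 0 0.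
    by rewrite !mulmxBl !mxE; lra.
  rewrite mxE (bigD1 i) //= big1 ?addr0 => [|c ci]; last first.
    by rewrite !mxE /U (negPf ci) subrr mul0r.
  rewrite !mxE /U eqxx -(subnKC (ltnW st)) repunitD -/r mulnDr mulnA -expnD.
  rewrite !PoszD !intrD -!pmulrn (natrM _ (p ^ (J + s))%N) natrX -/P -/q.
  by field; rewrite gt_eqF.
move=> h1; have := Gx s sN; have := Gx t tN => h2 h3.
have near_r : near_int (6 / P ^+ J) (r%:R * v i 0).
  exists w; apply: (@le_trans _ _ (6 / q)); last first.
    rewrite ler_pM2l ?ltr0n // lef_pV2 ?posrE //.
    by rewrite ler_eXn2l ?ltr1n // leq_addr.
  move: h1; rewrite !ler_pdivlMr // -[X in _ * X <= 4](gtr0_norm q0).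
  rewrite -[X in _ * X <= 6](gtr0_norm q0) -!normrM mulrBl divfK ?gt_eqF // => h1.
  rewrite mulrBl (mulrC _ q) -diff.
  move: h1 h2 h3 => /ler_normlP[h1 h1'] /ler_normlP[h2 h2'] /ler_normlP[h3 h3'].
  by apply/ler_normlP; split; lra.
have /dvdnP[c ->] : (r %| slope_denom p N)%N.
  by apply: repunit_dvd_slope_denom; lia.
have r1 : (0 < r)%N by rewrite /r -(ltn_predK (n := t - s) (m := 0)) ?subn_gt0 // repunitS.
have := near_intM c near_r; rewrite natrM !mulrA; apply: near_intW.
rewrite -!mulrA ler_wpM2l // ler_peMl ?divr_ge0 ?(ltW (Pgt0 J)) //.
by rewrite ler1n.
Qed.

(** * A function with discrete gradient is affine *)

Lemma box_convex (R : realType) (m : nat) (a b x y : 'rV[R]_m) (t : R) :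
  box a b x -> box a b y -> 0 <= t <= 1 -> box a b (x + t *: (y - x)).
Proof.
move=> xab yab /andP[t0 t1] i; rewrite !mxE.
have /andP[h1 h2] := xab i; have /andP[h3 h4] := yab i.
by apply/andP; split; nra.
Qed.

(** Along a segment of the box the function has zero derivative.  The parameter
    is clamped to [0, 1], so that the derivative vanishes on the whole real line
    and end points need no separate treatment. *)
Lemma gradient0_box_const (R : realType) (m : nat) (a b : 'rV[R]_m) h :
  (forall x, box a b x -> gradient_within (box a b) h x 0) ->
  forall x y, box a b x -> box a b y -> h x = h y.
Proof.
move=> hflat x y xab yab.
pose clamp (t : R) := if t < 0 then 0 else if 1 < t then 1 else t.
have clamp01 t : 0 <= clamp t <= 1.
  by rewrite /clamp; case: (ltP t 0) => ?; [|case: (ltP 1 t) => ?]; apply/andP; split; lra.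
have clamp_lip s t : `|clamp s - clamp t| <= `|s - t|.
  have h1 := ler_norm (s - t); have := ler_norm (t - s); rewrite distrC => h2.
  by apply/ler_normlP; rewrite /clamp; case: (ltP t 0) => ?; [|case: (ltP 1 t) => ?];
    (case: (ltP s 0) => ?; [|case: (ltP 1 s) => ?]); split; lra.
pose seg t := x + clamp t *: (y - x).
have seg_lip s t : `|seg s - seg t| <= `|s - t| * (`|y - x| + 1).
  rewrite /seg opprD addrACA subrr add0r -scalerBl normrZ.
  by rewrite ler_pM // lerDl.
have c0 : 0 < `|y - x| + 1 by rewrite ltr_wpDl.
have seg_box t : box a b (seg t) by apply: box_convex.
have der t : is_derive t (1 : R) (h \o seg) 0.
  have L : (fun u : R => u^-1 *: ((h \o seg) (u *: 1 + t) - (h \o seg) t)) @ 0^' --> (0 : R).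
    apply/cvgrPdist_le => e e0.
    have [d d0 hd] := gradient_withinP (hflat _ (seg_box t)) (divr_gt0 e0 c0).
    near=> u.
    have u0 : u != 0 by near: u; exact: nbhs_dnbhs_neq.
    have ud : `|u| < d / (`|y - x| + 1).
      by near: u; apply: dnbhs0_lt; rewrite divr_gt0.
    have := seg_lip (u *: 1 + t) t; rewrite addrK [u *: 1]mulr1 => su.
    have := hd _ (seg_box (u + t)).
    rewrite mulmx0 mxE subr0 => /(_ _)/le_trans-/(_ _ _)hu.
    rewrite sub0r normrN normrM normfV /= ler_pdivrMl ?normr_gt0 //.
    apply: hu.
      by apply: le_lt_trans su _; rewrite -ltr_pdivlMr.
    by rewrite mulrAC ler_pdivrMr // -mulrA mulrCA ler_pM2l.
  by split; [apply: cvgP L | apply: cvg_lim L].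
have seg0 : seg 0 = x by rewrite /seg /clamp ltxx ltr10 scale0r addr0.
have seg1 : seg 1 = y by rewrite /seg /clamp ltr10 ltxx scale1r subrKC.
by have := is_derive_0_is_cst 0 1 der; rewrite /= seg0 seg1.
Unshelve. all: by end_near.
Qed.

(** A differentiable function is continuous, and a continuous function with
    values in Z / d is locally constant. *)
Lemma int_valued_gradient0 (R : realType) (m : nat) (D : set 'rV[R]_m) f x v (d : nat) :
  (0 < d)%N -> (forall y, D y -> exists w : int, d%:R * f y = w%:~R) -> D x ->
  gradient_within D f x v -> gradient_within D f x 0.
Proof.
move=> d0 fint Dx fv e e0; rewrite near_withinE.
have dR : 0 < d%:R :> R by rewrite ltr0n.
have [r r0 hr] := gradient_withinP fv ltr01.
pose S := \sum_c `|v c 0|.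
have S0 : 0 <= S by apply: sumr_ge0.
have s0 : 0 < Num.min r (1 / (d%:R * (1 + S))).
  by rewrite lt_min r0 divr_gt0 // mulr_gt0 // ltr_pwDl.
apply/nbhs_ballP; exists (Num.min r (1 / (d%:R * (1 + S)))) => //= y.
rewrite mx_norm_ball /ball_ /= distrC lt_min => /andP[yr yS] Dy.
have vS : `|((y - x) *m v) 0 0| <= `|y - x| * S.
  rewrite mxE (le_trans (ler_norm_sum _ _ _)) // mulr_sumr.
  apply: ler_sum => c _; rewrite normrM ler_wpM2r //.
  exact: (elimT (row_normP _ (normr_ge0 _))).
have fyx : `|f y - f x| < 1 / d%:R.
  have -> : f y - f x = (f y - f x - ((y - x) *m v) 0 0) + ((y - x) *m v) 0 0.
    by rewrite subrK.
  apply: le_lt_trans (ler_normD _ _) _; have h1 := hr y Dy yr; rewrite mul1r in h1.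
  apply: le_lt_trans (lerD h1 vS) _.
  suff : `|y - x| * (1 + S) < 1 / d%:R by rewrite mulrDr mulr1.
  rewrite -ltr_pdivlMr ?ltr_pwDl //; apply: lt_le_trans yS _.
  by rewrite !mul1r invfM.
have -> : f y = f x.
  have [w wy] := fint y Dy; have [w' wx] := fint x Dx.
  apply: (@mulfI _ d%:R); rewrite ?gt_eqF // wx wy.
  have : `|(w - w')%:~R| < 1 :> R.
    by rewrite intrB -wx -wy -mulrBr normrM gtr0_norm // mulrC -ltr_pdivlMr.
  rewrite -intr_norm -[1]/(1%:~R) ltr_int => h; congr (_ %:~R); lia.
by rewrite subrr mulmx0 mxE subr0 normr0 mulr_ge0 // ltW.
Qed.

(** The gradient is itself differentiable with values in a discrete set, so
    [gradient0_box_const] applies first to its entries and then to the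
    difference of f and the linear form obtained. *)
Lemma int_gradient_affine (R : realType) (m : nat) (a b : 'rV[R]_m) f (d : nat) :
  (0 < d)%N -> C2_on (box a b) f -> box a b a ->
  (forall x v i, box a b x -> gradient_within (box a b) f x v ->
     exists w : int, d%:R * v i 0 = w%:~R) ->
  exists (v : 'cV[R]_m) (c : R), (forall i, exists w : int, d%:R * v i 0 = w%:~R) /\
    forall x, box a b x -> f x = (x *m v) 0 0 + c.
Proof.
move=> d0 [g [H [fg gH _]]] aab fint.
have gc x : box a b x -> g x = g a.
  move=> xab; apply/colP => i.
  apply: (@gradient0_box_const R m a b (fun y => g y i 0)) => // y yab.
  apply: (int_valued_gradient0 d0 _ yab (gH i y yab)) => z zab.
  exact: fint zab (fg z zab).
exists (g a), (f a - (a *m g a) 0 0); split=> [i|x xab]; first exact: fint aab (fg a aab).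
suff <- : f x - (x *m g a) 0 0 = f a - (a *m g a) 0 0 by rewrite addrC subrK.
apply: (@gradient0_box_const R m a b (fun y => f y - (y *m g a) 0 0)) => // y yab.
move=> e e0; have := fg y yab e e0; rewrite gc //; apply: filterS => z.
by rewrite mulmx0 mulmxBl !mxE subr0; set u := _ - _ - _; set v := _ - _ - _;
  have -> : u = v by rewrite /u /v; lra.
Qed.

(** * Intercepts and the size of slopes *)

Definition intercept_denom (p k0 N : nat) : nat :=
  (\prod_(t < N) (p ^ (k0 * t.+1)).-1)%N.

Lemma coprime_intercept_denom (p k0 N : nat) :
  (0 < p)%N -> (0 < k0)%N -> coprime p (intercept_denom p k0 N).
Proof.
move=> p0 k00; rewrite /intercept_denom; elim/big_ind: _ => [|a b|t _].
- exact: coprimen1.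
- by rewrite coprimeMr => -> ->.
have [e eE] : exists e, (k0 * t.+1)%N = e.+1 by exists (k0 * t.+1).-1; rewrite prednK ?muln_gt0 ?k00.
rewrite eE expnS; set r := (p * _)%N.
have r0 : (0 < r)%N by rewrite muln_gt0 p0 expn_gt0 p0.
apply: (@coprime_dvdl _ r); first exact: dvdn_mulr.
by rewrite -{1}(prednK r0) coprimeSn.
Qed.

Lemma repunit_pred (q t : nat) : (0 < q)%N -> (q.-1 * repunit q t)%N = (q ^ t).-1.
Proof. by move=> q0; rewrite predn_exp. Qed.

Lemma affine_row_coord (R : realType) (m n : nat) (A : 'M[R]_(m, n)) (B : 'rV[R]_n) x j :
  (x *m A + B) 0 j = \sum_i x 0 i * A i j + B 0 j.
Proof. by rewrite !mxE. Qed.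

(** With q = p^k0, the t-th point has the block p^J h (1 + q + ... + q^t) of
    length J + k0 (t + 1): the digits of h repeated t + 1 times in front of J zeros.
    Its leading digits are h, so it lies in the prescribed cylinder whatever t
    is, while its low-order digits agree with those of all later blocks. *)
Lemma intercept_denom_clears (R : realType) (p m n : nat) (Aut : automaton p m n)
    (N k0 D : nat) (h : 'I_m -> nat) (A : 'M[R]_(m, n)) (B : 'rV[R]_n) :
  (1 < p)%N -> pigeonhole_bound R Aut N -> (forall i, h i < p ^ k0)%N ->
  (forall i j, exists w : int, D%:R * A i j = w%:~R) ->
  (forall x : 'rV[R]_m, (forall i, (h i)%:R <= p%:R ^+ k0 * x 0 i <= (h i)%:R + 1) ->
     lifted_plot R Aut (row_mx x (x *m A + B))) ->
  forall j, exists w : int, (D * intercept_denom p k0 N)%:R * B 0 j = w%:~R.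
Proof.
move=> p1 HN hk0 DA Q j.
have p0 : (0 < p)%N := ltnW p1.
apply: (@near_int_integral _ _ ((D * intercept_denom p k0 N)%:R * 4) _ p1) => J.
set P : R := p%:R.
have Pgt0 c : 0 < P ^+ c by rewrite exprn_gt0 // ltr0n.
pose q := (p ^ k0)%N; have q0 : (0 < q)%N by rewrite expn_gt0 p0.
pose k t := (J + k0 * t.+1)%N.
have kE t : (p ^ k t = p ^ J * q ^ t.+1)%N by rewrite expnD expnM.
pose U t i : nat := (p ^ J * h i * repunit q t.+1)%N.
pose x t : 'rV[R]_m := \row_i (((U t i)%:R + 1 / 2) / P ^+ k t).
pose y t : 'rV[R]_n := x t *m A + B.
have Qx t : lifted_plot R Aut (row_mx (x t) (y t)).
  apply: Q => i; rewrite mxE.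
  have -> : P ^+ k0 * (((U t i)%:R + 1 / 2) / P ^+ k t) =
      ((U t i)%:R + 1 / 2) / (p ^ J * q ^ t)%N%:R.
    rewrite /k mulnS addnCA exprD exprD natrM -expnM !natrX -/P.
    by field; rewrite !gt_eqF.
  rewrite ler_pdivlMr ?ler_pdivrMr ?ltr0n ?muln_gt0 ?expn_gt0 ?p0 ?q0 //.
  (* The digits of h repeated t times form a number below q^t, as h < q. *)
  have UE : (U t i + p ^ J <= (h i).+1 * (p ^ J * q ^ t))%N.
    have : (h i * repunit q t <= (q ^ t).-1)%N.
      by rewrite -repunit_pred // leq_mul2r; apply/orP; right; have := hk0 i; rewrite -/q; lia.
    rewrite /U -addn1 repunitD /repunit big_ord1 expn0 muln1 -/(repunit q t).
    have : (0 < q ^ t)%N by rewrite expn_gt0 q0.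
    by set X := (p ^ J)%N; set Y := (q ^ t)%N; set Z := repunit q t => h1 h2; nia.
  have LE : (h i * (p ^ J * q ^ t) <= U t i)%N.
    rewrite /U -addn1 repunitD /repunit big_ord1 expn0 muln1.
    by set X := (p ^ J)%N; set Y := (q ^ t)%N; nia.
  have J1 : 1 <= (p ^ J)%N%:R :> R by rewrite ler1n expn_gt0 p0.
  move: UE LE; rewrite -!(ler_nat R) natrD !(natrM R (h i)) (natrM _ (h i).+1) -addn1 natrD.
  by move=> UE LE; apply/andP; split; lra.
have Ux t i : (U t i)%:Z%:~R < P ^+ k t * x t 0 i < (U t i)%:Z%:~R + 1.
  rewrite mxE mulrC divfK ?gt_eqF // -pmulrn; apply/andP; split; lra.
have UD s t i : (s < t)%N ->
    U t i = (U s i + p ^ k s * (h i * repunit q (t - s)))%N.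
  move=> st; have E : t.+1 = (s.+1 + (t - s))%N by lia.
  by rewrite kE /U E repunitD; lia.
have [||s [t [/andP[st tN] /(_ j)]]] := HN k k (fun t i => (U t i)%:Z) x y (fun t _ => Qx t).
- by move=> t i _; apply: Ux.
- move=> s t /andP[st tN]; have kst : (k s <= k t)%N by rewrite leq_add2l leq_mul2l; lia.
  split=> // i; exists (h i * repunit q (t - s))%N%:Z.
  by rewrite -PoszM -PoszD (UD s t i st).
have q1 := Pgt0 (k s).
have [W WA] : exists W : int, D%:R * (\sum_i (h i * repunit q (t - s))%N%:R * A i j) = W%:~R.
  have /choice[w wA] := fun i => DA i j.
  exists (\sum_i (h i * repunit q (t - s))%N%:Z * w i).
  rewrite mulr_sumr raddf_sum; apply: eq_bigr => i _ /=.
  by rewrite intrM -wA -pmulrn mulrCA.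
have -> : (P ^+ k t * y t 0 j - P ^+ k s * y s 0 j) / P ^+ k s =
    \sum_i (h i * repunit q (t - s))%N%:R * A i j + (q ^ (t - s)).-1%:R * B 0 j.
  have yE r : P ^+ k r * y r 0 j = \sum_i ((U r i)%:R + 1 / 2) * A i j + P ^+ k r * B 0 j.
    rewrite affine_row_coord mulrDr mulr_sumr; congr (_ + _).
    by apply: eq_bigr => i _; rewrite mxE; field; rewrite gt_eqF.
  have SE : \sum_i ((U t i)%:R + 1 / 2) * A i j = \sum_i ((U s i)%:R + 1 / 2) * A i j +
      P ^+ k s * \sum_i (h i * repunit q (t - s))%N%:R * A i j.
    rewrite mulr_sumr -big_split; apply: eq_bigr => i _ /=.
    by rewrite (UD s t) // natrD (natrM _ (p ^ k s)%N) natrX -/P; ring.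
  have kD : P ^+ k t = P ^+ k s * ((q ^ (t - s)).-1%:R + 1).
    rewrite natr1 prednK ?expn_gt0 ?p0 //.
    have PE c : P ^+ c = (p ^ c)%N%:R by rewrite natrX.
    rewrite !PE -natrM !kE.
    by rewrite -mulnA -expnD; congr (_ * q ^ _)%N%:R; lia.
  by rewrite !yE SE kD; field; rewrite gt_eqF.
move=> /(near_intM D)[w]; rewrite mulrDr WA => wP.
have nB : near_int (D%:R * (4 / P ^+ k s)) (D%:R * ((q ^ (t - s)).-1%:R * B 0 j)).
  by exists (w - W); rewrite intrB opprB addrA addrAC addrC addrA.
have /dvdnP[c ->] : ((q ^ (t - s)).-1 %| intercept_denom p k0 N)%N.
  have [e eE] : exists e, (t - s)%N = e.+1 by exists (t - s).-1; lia.
  have eN : (e < N)%N by lia.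
  rewrite eE /q -expnM /intercept_denom (bigD1 (Ordinal eN)) //=; exact: dvdn_mulr.
have [c0|c0] := posnP ((q ^ (t - s)).-1).
  by rewrite c0 muln0 muln0 !mul0r; exists 0; rewrite subrr normr0.
have := near_intM c nB; rewrite !natrM.
rewrite (_ : c%:R * (D%:R * ((q ^ (t - s)).-1%:R * _)) =
  D%:R * (c%:R * (q ^ (t - s)).-1%:R) * B 0 j); last by ring.
apply: near_intW.
have r1 : 1 <= (q ^ (t - s)).-1%:R :> R by rewrite ler1n.
have PJ : P ^+ J <= P ^+ k s by rewrite ler_eXn2l ?ltr1n // leq_addr.
have Q0 := Pgt0 J.
rewrite mulrCA -!mulrA ler_wpM2l // ler_wpM2l // mulrCA ler_wpM2l //.
apply: (@le_trans _ _ (P ^+ J)^-1); first by rewrite lef_pV2 ?posrE.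
by rewrite ler_peMl // invr_ge0 ltW.
Qed.

(** All N + 1 points lie in the same cylinder of depth k, so two of their output
    blocks differ by a bounded amount modulo p^k; a slope larger than the bound
    would spread them further apart than that, without wrapping around once p^k
    exceeds the slope. *)
Lemma slope_bound (R : realType) (p m n : nat) (Aut : automaton p m n)
    (N : nat) (A : 'M[R]_(m, n)) (B : 'rV[R]_n) :
  (1 < p)%N -> pigeonhole_bound R Aut N ->
  (forall x : 'rV[R]_m, lifted_plot R Aut (row_mx x (x *m A + B))) ->
  forall i j, `|A i j| <= (4 * (N + 2))%N%:R.
Proof.
move=> p1 HN Q i j.
set P : R := p%:R.
have Pgt0 c : 0 < P ^+ c by rewrite exprn_gt0 // ltr0n ltnW.
have [k /(_ k (leqnn _)) kA] := @expn_unbounded R p (`|A i j| + 4) p1.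
have k0 := Pgt0 k; rewrite -/P in kA.
have N2 : 0 < (N + 2)%N%:R :> R by rewrite ltr0n addn2.
(* The points are equally spaced in the coordinate i, strictly inside the cell
   of the block 0; the value 1 / 2 keeps the other coordinates inside as well. *)
pose tau (t : nat) (c : 'I_m) : R := if c == i then t.+1%:R / (N + 2)%N%:R else 1 / 2.
pose x t : 'rV[R]_m := \row_c (tau t c / P ^+ k).
have [||s [t [/andP[st tN] /(_ j)]]] :=
  HN (fun=> k) (fun=> k) (fun _ _ => 0) x _ (fun t _ => Q (x t)).
- move=> t c tN; rewrite mxE mulrC divfK ?gt_eqF // /tau add0r.
  case: ifP => _; last by apply/andP; split; lra.
  rewrite divr_gt0 //= ltr_pdivrMr // mul1r ltr_nat; lia.
- by move=> s t _; split=> // c; exists 0; rewrite mulr0.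
rewrite -mulrBr !affine_row_coord opprD addrACA subrr addr0 -sumrB.
rewrite (bigD1 i) //= big1 ?addr0 => [|c ci]; last first.
  by rewrite !mxE /tau (negPf ci) subrr.
set d : R := (t - s)%N%:R / (N + 2)%N%:R.
rewrite -mulrBl !mxE /tau eqxx -!mulrBl -natrB ?ltnS ?(ltnW st) // subSS -/d.
move=> [w].
have -> : P ^+ k * (d / P ^+ k * A i j) = d * A i j by field; rewrite gt_eqF.
rewrite -[w%:~R](mulfK (lt0r_neq0 k0)) -mulrBl normrM normfV (gtr0_norm k0).
rewrite ler_pM2r ?invr_gt0 //.
have d0 : 0 < d by rewrite divr_gt0 // ltr0n subn_gt0.
have d1 : d <= 1 by rewrite ler_pdivrMr // mul1r ler_nat; lia.
have dA : `|d * A i j| <= `|A i j| by rewrite normrM gtr0_norm // ler_piMl.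
have [->|w0] := eqVneq w 0.
  rewrite mul0r subr0 normrM gtr0_norm // natrM -ler_pdivlMl // => h.
  apply: le_trans h _; rewrite mulrC ler_wpM2l // /d invf_div ler_pdivrMr ?ltr0n ?subn_gt0 //.
  by rewrite ler_peMr ?ler1n ?subn_gt0 // ltW.
have w1 : 1 <= `|w%:~R| :> R by rewrite -intr_norm -[1]/(1%:~R) ler_int; lia.
have w2 : P ^+ k <= `|w%:~R * P ^+ k| by rewrite normrM (gtr0_norm k0) ler_peMl // ltW.
move=> h; have := ler_normB (d * A i j) (d * A i j - w%:~R * P ^+ k).
rewrite opprB addrC subrK => h2.
by exfalso; lra.
Qed.

(** * From a box to the whole space *)

Lemma row_norm_lt (R : realType) (m : nat) (x : 'rV[R]_m) (e : R) :
  0 < e -> (forall i, `|x 0 i| < e) -> `|x| < e.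
Proof.
move=> e0 h; have -> : `|x| = mx_norm x by []; rewrite mx_normrE.
by apply/bigmax_ltP; split => // -[i j] _ /=; rewrite ord1.
Qed.

Lemma torus_plot_lifted (R : realType) (p m n : nat) (Aut : automaton p m n) v :
  torus_plot R Aut v -> lifted_plot R Aut v.
Proof.
move=> [v0 v0P <-] e e0.
have [u [[z [k [k0 uE]]] vu]] := v0P _ (nbhsx_ballx v0 e e0).
exists z, k; split=> // i; exists (- Num.floor (v0 0 i)).
rewrite mxE intrN opprK subrK /word_point -uE.
move: vu; rewrite mx_norm_ball /ball_ /= => vu; apply: le_lt_trans vu.
by have := elimT (row_normP _ (normr_ge0 (v0 - u))) (lexx _) i; rewrite !mxE.
Qed.

Lemma lifted_plot_periodic (R : realType) (p m n : nat) (Aut : automaton p m n)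
    (v v' : 'rV[R]_(m + n)) :
  (forall i, exists w : int, v' 0 i = v 0 i + w%:~R) ->
  lifted_plot R Aut v -> lifted_plot R Aut v'.
Proof.
move=> vv' Q e /Q[z [k [k0 zk]]]; exists z, k; split=> // i.
have [w wP] := zk i; have [w' w'P] := vv' i; exists (w + w').
by rewrite w'P intrD [w%:~R + _]addrC opprD addrA addrK.
Qed.

Lemma lifted_plot_closed (R : realType) (p m n : nat) (Aut : automaton p m n)
    (v : 'rV[R]_(m + n)) :
  (forall e : R, 0 < e -> exists v', lifted_plot R Aut v' /\
     forall i, `|v 0 i - v' 0 i| < e) ->
  lifted_plot R Aut v.
Proof.
move=> h e e0; have e2 : 0 < e / 2 by rewrite divr_gt0.
have [v' [Q' vv']] := h _ e2; have [z [k [k0 zk]]] := Q' _ e2.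
exists z, k; split=> // i; have [w wP] := zk i; exists w.
move: wP (vv' i) => /ltr_normlP[h1 h2] /ltr_normlP[h3 h4].
by apply/ltr_normlP; split; lra.
Qed.

Lemma word_point_itv (R : realType) (p m n : nat) (Aut : automaton p m n) z k i :
  (0 < p)%N -> 0 <= word_point R Aut z k 0 i < 1.
Proof.
move=> p0.
have frac q (y : padic_vec p q) (j : 'I_q) : 0 <= trunc_frac R y k 0 j < 1.
  have Pk : 0 < p%:R ^+ k :> R by rewrite exprn_gt0 // ltr0n.
  rewrite trunc_fracE divr_ge0 ?(ltW Pk) //= ltr_pdivrMr // mul1r -natrX ltr_nat.
  exact: numeral_lt.
by rewrite /word_point; case: (split_ordP i) => j ->; rewrite !(row_mxEl, row_mxEr).
Qed.

(** For v in the fundamental domain, word points have coordinates in [0, 1), so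
    only the integer shifts -1, 0, 1 can occur.  If none of these finitely many
    shifts of v were in the closed plot, some common distance would separate
    all of them from every word point. *)
Lemma lifted_torus_plot (R : realType) (p m n : nat) (Aut : automaton p m n)
    (v : 'rV[R]_(m + n)) :
  (0 < p)%N -> (forall i, 0 <= v 0 i < 1) -> lifted_plot R Aut v ->
  torus_plot R Aut v.
Proof.
move=> p0 v01 Q.
pose rep (W : {ffun 'I_(m + n) -> 'I_3}) : 'rV[R]_(m + n) :=
  \row_i (v 0 i - ((W i)%:Z - 1)%:~R).
suff [W WP] : exists W, plot R Aut (rep W).
  exists (rep W) => //; apply/rowP => i; rewrite !mxE.
  suff -> : Num.floor (v 0 i - ((W i)%:Z - 1)%:~R) = - ((W i)%:Z - 1).
    by rewrite intrN opprK subrK.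
  have /andP[v0 v1] := v01 i.
  by apply: floor_def; rewrite !intrD !intrN; apply/andP; split; lra.
apply: contrapT => noW.
have /choice[e eP] : forall W, exists e : R, 0 < e /\ forall z k, (0 < k)%N ->
    ~ forall i, `|rep W 0 i - word_point R Aut z k 0 i| < e.
  move=> W; apply: contrapT => ne; apply: noW; exists W => B /nbhs_ballP[e /= e0 eB].
  apply: contrapT => nB; apply: ne; exists e; split=> // z k k0 zk; apply: nB.
  exists (word_point R Aut z k); split; first by exists z, k.
  apply: eB; rewrite mx_norm_ball /ball_ /=.
  by apply: row_norm_lt => // i; have := zk i; rewrite !mxE.
pose d := \big[Num.min/1]_W e W.
have d0 : 0 < d by apply: lt_bigmin => // W _; case: (eP W).
have [z [k [k0 /choice[w wP]]]] := Q d d0.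
have w1 i : (0 <= w i + 1 < 3)%R.
  have := wP i; have := word_point_itv R Aut z k i p0 => /andP[t0 t1].
  have /andP[v0 v1] := v01 i; have : d <= 1 by apply: bigmin_le_id.
  move=> d1 /ltr_normlP[h1 h2].
  have h3 : w i < 2 by rewrite -(ltr_int R); lra.
  have h4 : -2 < w i by rewrite -(ltr_int R); lra.
  by apply/andP; split; lia.
pose W : {ffun 'I_(m + n) -> 'I_3} := [ffun i => inord (absz (w i + 1))].
have [_ /(_ z k k0)] := eP W; apply=> i.
rewrite mxE ffunE inordK; last by have := w1 i; lia.
rewrite gez0_abs ?addrK; last by case/andP: (w1 i).
by apply: lt_le_trans (wP i) _; apply: bigmin_le.
Qed.

(** Multiplying a word point by p^l drops, modulo 1, the last l letters of the
    word.  The word must be longer than l, which holds near a point with some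
    coordinate outside p^-l Z. *)
Lemma lifted_plot_scale (R : realType) (p m n : nat) (Aut : automaton p m n)
    (x : 'rV[R]_m) (y : 'rV[R]_n) (l : nat) (i0 : 'I_m) :
  (0 < p)%N -> (forall w : int, p%:R ^+ l * x 0 i0 <> w%:~R) ->
  lifted_plot R Aut (row_mx x y) ->
  lifted_plot R Aut (row_mx (p%:R ^+ l *: x) (p%:R ^+ l *: y)).
Proof.
move=> p0 xnint Q e e0.
set P : R := p%:R.
have Pgt0 c : 0 < P ^+ c by rewrite exprn_gt0 // ltr0n.
set t := P ^+ l * x 0 i0 in xnint.
have [d [d0 dint]] : exists d : R, 0 < d /\ forall w : int, d <= `|t - w%:~R|.
  have ft := floor_le t; have := floorD1_gt t; rewrite intrD => tf.
  have tf' : (Num.floor t)%:~R < t.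
    by rewrite lt_neqAle ft andbT; apply/eqP => E; apply: (xnint (Num.floor t)).
  exists (Num.min (t - (Num.floor t)%:~R) ((Num.floor t)%:~R + 1 - t)).
  rewrite lt_min !subr_gt0 tf' tf; split=> // w; rewrite ge_min.
  have [wf|fw] := leP w (Num.floor t).
    have {}wf : w%:~R <= (Num.floor t)%:~R :> R by rewrite ler_int.
    by rewrite (le_trans _ (ler_norm _)) //; lra.
  have {}fw : (Num.floor t)%:~R + 1 <= w%:~R :> R by rewrite -[1]/(1%:~R) -intrD ler_int; lia.
  by rewrite distrC [X in _ || X](le_trans _ (ler_norm _)) ?orbT //; lra.
pose e' := Num.min d e / P ^+ l.
have e'0 : 0 < e' by rewrite divr_gt0 // lt_min d0.
have scale (s : R) : `|s| < e' -> `|P ^+ l * s| < d /\ `|P ^+ l * s| < e.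
  rewrite normrM (gtr0_norm (Pgt0 l)) ltr_pdivlMr // mulrC lt_min.
  by move=> /andP[].
have [z [k [k0 zk]]] := Q e' e'0.
have kl : (l < k)%N.
  rewrite ltnNge; apply/negP => kl.
  have [w] := zk (lshift n i0); rewrite /word_point !row_mxEl trunc_fracE -/P.
  move=> /scale[+ _]; rewrite !mulrBr -/t -addrA -opprD.
  rewrite (_ : P ^+ l * w%:~R + _ =
      ((p ^ l)%:Z * w + (p ^ (l - k) * numeral z k i0)%N%:Z)%:~R); last first.
    have PE : P ^+ l = P ^+ (l - k) * P ^+ k by rewrite -exprD subnK.
    rewrite intrD intrM -!pmulrn natrM !natrX -/P PE.
    by field; rewrite gt_eqF.
  by apply/negP; rewrite -leNgt.
(* The shortened word is the one of length a. *)
have [a kE] : exists a, k = (a + l)%N by exists (k - l)%N; rewrite subnK // ltnW.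
have key q (y' : padic_vec p q) (s : 'rV[R]_q) j w :
  `|s 0 j - w%:~R - trunc_frac R y' k 0 j| < e' ->
  exists w' : int, `|(P ^+ l *: s) 0 j - w'%:~R - trunc_frac R y' a 0 j| < e.
  move=> /scale[_]; rewrite !trunc_fracE -/P kE numeral_cat => h.
  exists ((p ^ l)%:Z * w + (numeral (drop_digits a y') l j)%:Z).
  rewrite intrD intrM -!pmulrn natrX -/P mxE.
  congr (`|_| < e): h; rewrite natrD natrM natrX -/P exprD.
  by field; rewrite !gt_eqF.
exists z, a; split; first by lia.
move=> i; have [w] := zk i; rewrite /word_point.
by case: (split_ordP i) => j ->; rewrite !(row_mxEl, row_mxEr); apply: key.
Qed.

Lemma expn_mod1_unbounded (R : realType) (p E : nat) (x : R) :
  (1 < p)%N -> (0 < E)%N -> coprime p E ->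
  exists l, x < p%:R ^+ l /\ exists c : nat, (p ^ l = 1 + c * E)%N.
Proof.
move=> p1 E0 pE; have [l0 l0P] := @expn_unbounded R p x p1.
exists (totient E * l0)%N; split.
  by apply: l0P; rewrite leq_pmull // totient_gt0.
have pE1 : (p ^ (totient E * l0) = 1 %[mod E])%N.
  by rewrite expnM -modnXm Euler_exp_totient // modnXm exp1n.
have pl : (0 < p ^ (totient E * l0))%N by rewrite expn_gt0 ltnW.
move/eqP: pE1; rewrite eqn_mod_dvd // => /dvdnP[c cE]; exists c; lia.
Qed.

(** Any x is congruent modulo E to p^l x' for some x' of the box, when p^l exceeds
    E divided by the sides of the box.  Since p^l = 1 modulo E, multiplication
    by p^l carries the point of the graph above x' to the one above x, modulo
    integers. *)
Lemma affine_spread_nonint (R : realType) (p m n : nat) (Aut : automaton p m n)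
    (a b : 'rV[R]_m) (E : nat) (A : 'M[R]_(m, n)) (B : 'rV[R]_n) (i0 : 'I_m) :
  (1 < p)%N -> (0 < E)%N -> coprime p E -> (forall i, a 0 i < b 0 i) ->
  (forall i j, exists w : int, E%:R * A i j = w%:~R) ->
  (forall j, exists w : int, E%:R * B 0 j = w%:~R) ->
  (forall x, box a b x -> lifted_plot R Aut (row_mx x (x *m A + B))) ->
  forall x : 'rV[R]_m, (forall w : int, x 0 i0 <> w%:~R) ->
    lifted_plot R Aut (row_mx x (x *m A + B)).
Proof.
move=> p1 E0 pE ab EA EB Q x xnint.
have ER : 0 < E%:R :> R by rewrite ltr0n.
set P : R := p%:R.
have Pgt0 c : 0 < P ^+ c by rewrite exprn_gt0 // ltr0n ltnW.
have [l [lab [c lc]]] : exists l, (forall i, E%:R / (b 0 i - a 0 i) < P ^+ l) /\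
    exists c : nat, (p ^ l = 1 + c * E)%N.
  have [l [lab lc]] := expn_mod1_unbounded (\sum_i E%:R / (b 0 i - a 0 i)) p1 E0 pE.
  exists l; split=> // i; apply: le_lt_trans lab.
  rewrite (bigD1 i) //= lerDl; apply: sumr_ge0 => i' _.
  by rewrite divr_ge0 // ltW // subr_gt0.
have /choice[h hP] : forall i, exists h : int,
    P ^+ l * a 0 i <= x 0 i + E%:R * h%:~R <= P ^+ l * b 0 i.
  move=> i; exists (Num.floor ((P ^+ l * b 0 i - x 0 i) / E%:R)).
  set s := _ / _; have fs := floor_le s; have := floorD1_gt s; rewrite intrD => sf.
  have sE : E%:R * s = P ^+ l * b 0 i - x 0 i by rewrite mulrC divfK ?gt_eqF.
  have := lab i; rewrite ltr_pdivrMr ?subr_gt0 // => lb.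
  have h1 : E%:R * (Num.floor s)%:~R <= E%:R * s by rewrite ler_pM2l.
  have h2 : E%:R * s < E%:R * ((Num.floor s)%:~R + 1) by rewrite ltr_pM2l.
  by apply/andP; split; lra.
pose x' : 'rV[R]_m := \row_i ((x 0 i + E%:R * (h i)%:~R) / P ^+ l).
have xE i : P ^+ l * x' 0 i = x 0 i + E%:R * (h i)%:~R.
  by rewrite mxE mulrC divfK ?gt_eqF.
have x'ab : box a b x'.
  move=> i; have /andP[h1 h2] := hP i.
  by rewrite -(ler_pM2l (Pgt0 l)) -(ler_pM2l (Pgt0 l) (x' 0 i)) xE h1.
have x'nint w : P ^+ l * x' 0 i0 <> w%:~R.
  rewrite xE => H; apply: (xnint (w - E%:Z * h i0)).
  by rewrite intrB intrM -pmulrn -H addrK.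
have scaleE q (s : 'rV[R]_q) j : (p%:R ^+ l *: s) 0 j = P ^+ l * s 0 j by rewrite mxE.
apply: lifted_plot_periodic (lifted_plot_scale (ltnW p1) x'nint (Q _ x'ab)) => i.
case: (split_ordP i) => {}i ->; rewrite !(row_mxEl, row_mxEr) scaleE.
  by exists (- (E%:Z * h i)); rewrite xE intrN intrM -pmulrn addrK.
have /choice[w wA] := fun i' => EA i' i; have [v vB] := EB i.
exists (- (\sum_i' h i' * w i' + c%:Z * v)).
rewrite !affine_row_coord mulrDr mulr_sumr.
have -> : \sum_i' P ^+ l * (x' 0 i' * A i' i) =
    \sum_i' x 0 i' * A i' i + (\sum_i' h i' * w i')%:~R.
  rewrite raddf_sum -big_split; apply: eq_bigr => i' _ /=.
  by rewrite mulrA xE intrM -wA; ring.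
have -> : P ^+ l = 1 + c%:R * E%:R by rewrite -natrX lc natrD natrM.
rewrite intrN intrD intrM -vB -pmulrn; ring.
Qed.

(** A point with an integer coordinate is a limit of points to which
    [affine_spread_nonint] applies. *)
Lemma affine_spread (R : realType) (p m n : nat) (Aut : automaton p m n)
    (a b : 'rV[R]_m) (E : nat) (A : 'M[R]_(m, n)) (B : 'rV[R]_n) :
  (1 < p)%N -> (0 < m)%N -> (0 < E)%N -> coprime p E -> (forall i, a 0 i < b 0 i) ->
  (forall i j, exists w : int, E%:R * A i j = w%:~R) ->
  (forall j, exists w : int, E%:R * B 0 j = w%:~R) ->
  (forall x, box a b x -> lifted_plot R Aut (row_mx x (x *m A + B))) ->
  forall x : 'rV[R]_m, lifted_plot R Aut (row_mx x (x *m A + B)).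
Proof.
move=> p1 m0 E0 pE ab EA EB Q x; pose i0 := Ordinal m0.
have Qn := affine_spread_nonint (i0 := i0) p1 E0 pE ab EA EB Q.
have [[w xw]|xn] := pselect (exists w : int, x 0 i0 = w%:~R); last first.
  by apply: Qn => w xw; apply: xn; exists w.
apply: lifted_plot_closed => e e0.
pose S := 1 + \sum_j `|A i0 j|.
have S1 : 1 <= S by rewrite lerDl sumr_ge0.
have S0 : 0 < S by apply: lt_le_trans S1.
(* Shifting x by d < 1 in one coordinate makes this coordinate non-integral and
   moves the image by less than e. *)
pose d := Num.min 1 (e / S) / 2.
have d0 : 0 < d by rewrite divr_gt0 // lt_min ltr01 divr_gt0.
have d1 : d < 1.
  have : Num.min 1 (e / S) <= 1 by rewrite ge_min lexx.
  by rewrite /d; lra.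
have dS : d * S < e.
  have : Num.min 1 (e / S) <= e / S by rewrite ge_min lexx orbT.
  rewrite ler_pdivlMr // /d; nra.
pose x' : 'rV[R]_m := x + d *: delta_mx 0 i0.
exists (row_mx x' (x' *m A + B)); split.
  apply: Qn => w'; rewrite !mxE !eqxx mulr1 xw => H.
  have h1 : w%:~R < w'%:~R :> R by lra.
  have h2 : w'%:~R < (w + 1)%:~R :> R by rewrite intrD; lra.
  by move: h1 h2; rewrite !ltr_int; lia.
move=> i; case: (split_ordP i) => {}i ->; rewrite !(row_mxEl, row_mxEr).
  rewrite !mxE opprD addrA subrr sub0r normrN normrM gtr0_norm //.
  apply: le_lt_trans dS; rewrite ler_pM2l //; apply: le_trans S1.
  by rewrite normr_nat lern1; case: (_ && _).
have -> : (x *m A + B) 0 i - (x' *m A + B) 0 i = - (d * A i0 i).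
  by rewrite /x' mulmxDl -scalemxAl -rowE !mxE; ring.
rewrite normrN normrM gtr0_norm //; apply: le_lt_trans dS; rewrite ler_pM2l //.
by rewrite /S (bigD1 i) //= addrCA lerDl addr_ge0 // sumr_ge0.
Qed.

(** * Rational entries coprime to p *)

Lemma rat_in_Zp_denom (p D : nat) (r : rat) (w : int) :
  coprime p D -> D%:R * r = w%:~R -> rat_in_Zp p r.
Proof.
move=> pD Dr; apply: coprime_dvdr pD.
have : (denq r %| D%:Z * numq r)%Z.
  apply/dvdzP; exists w; apply/eqP; rewrite -(eqr_int rat) !intrM -Dr.
  by rewrite -mulrA numqE pmulrn.
rewrite Gauss_dvdzl //.
by rewrite /coprimez /gcdz gcdnC; have := coprime_num_den r; rewrite /coprime => /eqP ->.
Qed.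

Lemma common_denom (p : nat) (I : finType) (r : I -> rat) :
  (1 < p)%N -> (forall i, rat_in_Zp p (r i)) ->
  exists E : nat, [/\ (0 < E)%N, coprime p E &
    forall i, exists w : int, E%:R * r i = w%:~R].
Proof.
move=> p1 rp; pose E := (\prod_i `|denq (r i)|)%N.
have pE : coprime p E.
  rewrite /E; elim/big_ind: _ => [|a b|i _]; last exact: rp.
    exact: coprimen1.
  by rewrite coprimeMr => -> ->.
exists E; split=> // [|i].
  by apply: prodn_gt0 => i; rewrite absz_gt0 denq_neq0.
exists ((\prod_(j | j != i) `|denq (r j)|)%N%:Z * numq (r i)).
rewrite /E (bigD1 i) //= natrM intrM numqE -pmulrn.
rewrite (_ : `|denq (r i)|%N%:R = (denq (r i))%:~R); last by rewrite pmulrn absz_denq.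
ring.
Qed.

Lemma denom_ratr (R : realType) (E : nat) (r : rat) (w : int) :
  (E%:R * r = w%:~R) <-> (E%:R * ratr r = w%:~R :> R).
Proof.
have -> : E%:R * ratr r = ratr (E%:R * r) :> R by rewrite rmorphM /= ratr_nat.
rewrite -(ratr_int R w); split=> [->//|]; exact: fmorph_inj.
Qed.

Lemma denom_rat (R : realType) (E : nat) (t : R) (w : int) :
  (0 < E)%N -> E%:R * t = w%:~R -> exists r : rat, ratr r = t.
Proof.
move=> E0 Et; exists (w%:~R / E%:R).
have ER : E%:R != 0 :> R by rewrite pnatr_eq0 -lt0n.
by rewrite fmorph_div /= ratr_int ratr_nat -Et mulrC mulKf.
Qed.

Lemma finite_bounded_frac_mx (m n E M : nat) : (0 < E)%N ->
  finite_set [set A : 'M[rat]_(m, n) | forall i j,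
    (exists w : int, E%:R * A i j = w%:~R) /\ `|A i j| <= M%:R].
Proof.
move=> E0; have ER : 0 < E%:R :> rat by rewrite ltr0n.
pose f (F : {ffun 'I_m * 'I_n -> 'I_(2 * (E * M)).+1}) : 'M[rat]_(m, n) :=
  \matrix_(i, j) (((F (i, j))%:Z - (E * M)%N%:Z)%:~R / E%:R).
apply: (@sub_finite_set _ _ (f @` [set: _])); last exact/finite_image/finite_finset.
move=> A AP; have /choice[w wP] : forall ij : 'I_m * 'I_n, exists w : int,
    E%:R * A ij.1 ij.2 = w%:~R by move=> ij; case: (AP ij.1 ij.2).
have wb ij : (0 <= w ij + (E * M)%N%:Z <= (2 * (E * M))%N%:Z)%R.
  have [_ Ab] := AP ij.1 ij.2.
  have : `|(w ij)%:~R| <= (E * M)%N%:Z%:~R :> rat.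
    by rewrite -wP normrM gtr0_norm // -pmulrn natrM ler_pM2l.
  by rewrite -intr_norm ler_int; lia.
exists [ffun ij => inord (absz (w ij + (E * M)%N%:Z))] => //.
apply/matrixP => i j; rewrite mxE ffunE inordK; last by have := wb (i, j); lia.
rewrite gez0_abs; last by case/andP: (wb (i, j)).
by rewrite addrK -(wP (i, j)) mulrC mulKf // gt_eqF.
Qed.

Lemma mod1E (R : realType) (k : nat) (y : 'rV[R]_k) i :
  mod1 y 0 i = y 0 i - (Num.floor (y 0 i))%:~R.
Proof. by rewrite mxE. Qed.

Lemma mod1_itv (R : realType) (k : nat) (y : 'rV[R]_k) i : 0 <= mod1 y 0 i < 1.
Proof.
rewrite mod1E subr_ge0 floor_le ltrBlDr addrC.
by have := floorD1_gt (y 0 i); rewrite intrD.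
Qed.

Lemma torus_point_lifted (R : realType) (p m n : nat) (Aut : automaton p m n)
    (x : 'rV[R]_m) (y : 'rV[R]_n) :
  torus_plot R Aut (row_mx (mod1 x) (mod1 y)) -> lifted_plot R Aut (row_mx x y).
Proof.
move=> /torus_plot_lifted; apply: lifted_plot_periodic => i.
by case: (split_ordP i) => {}i ->; rewrite !(row_mxEl, row_mxEr) mod1E;
  [exists (Num.floor (x 0 i)) | exists (Num.floor (y 0 i))]; rewrite subrK.
Qed.

Lemma lifted_torus_point (R : realType) (p m n : nat) (Aut : automaton p m n)
    (x : 'rV[R]_m) (y : 'rV[R]_n) :
  (0 < p)%N -> lifted_plot R Aut (row_mx x y) -> torus_plot R Aut (row_mx (mod1 x) (mod1 y)).
Proof.
move=> p0 Q; apply: lifted_torus_plot => // [i|].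
  by case: (split_ordP i) => {}i ->; rewrite !(row_mxEl, row_mxEr) mod1_itv.
apply: lifted_plot_periodic Q => i.
by case: (split_ordP i) => {}i ->; rewrite !(row_mxEl, row_mxEr) mod1E;
  [exists (- Num.floor (x 0 i)) | exists (- Num.floor (y 0 i))]; rewrite intrN.
Qed.

Lemma mod1_id (R : realType) (k : nat) (y : 'rV[R]_k) : mod1 (mod1 y) = mod1 y.
Proof.
apply/rowP => i; rewrite mod1E.
suff -> : Num.floor (mod1 y 0 i) = 0 by rewrite subr0.
by apply: floor_def; rewrite add0r; exact: mod1_itv.
Qed.

Lemma ex_inner_cylinder (R : realType) (p m : nat) (a b : 'rV[R]_m) :
  (1 < p)%N -> unit_box a b -> exists (k : nat) (h : 'I_m -> nat),
    [/\ (0 < k)%N, forall i, (h i < p ^ k)%N &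
      forall x : 'rV[R]_m, (forall i, (h i)%:R <= p%:R ^+ k * x 0 i <= (h i)%:R + 1) ->
        box a b x].
Proof.
move=> p1 ab; set P : R := p%:R.
have Pgt0 c : 0 < P ^+ c by rewrite exprn_gt0 // ltr0n ltnW.
have [k [k0 kab]] : exists k, (0 < k)%N /\ forall i, 2 / (b 0 i - a 0 i) < P ^+ k.
  have [k kP] := @expn_unbounded R p (\sum_i 2 / (b 0 i - a 0 i)) p1.
  exists k.+1; split=> // i; apply: le_lt_trans (kP k.+1 (leqnSn _)).
  rewrite (bigD1 i) //= lerDl; apply: sumr_ge0 => i' _.
  by have [_ h _] := ab i'; rewrite divr_ge0 // ltW // subr_gt0.
have /choice[h hP] : forall i, exists h : nat,
    P ^+ k * a 0 i <= h%:R /\ h%:R + 1 <= P ^+ k * b 0 i.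
  move=> i; have [a0 lt_ab _] := ab i; exists (Num.trunc (P ^+ k * a 0 i)).+1.
  have Pa0 : 0 <= P ^+ k * a 0 i by rewrite mulr_ge0 // ltW.
  have := kab i; rewrite ltr_pdivrMr ?subr_gt0 // => h.
  have h1 : (Num.trunc (P ^+ k * a 0 i))%:R <= P ^+ k * a 0 i by rewrite truncn_le.
  have h2 := truncnS_gt (P ^+ k * a 0 i).
  by rewrite -natr1 in h2 *; split; lra.
exists k, h; split=> // [i|x hx i].
  have [_ _ b1] := ab i; have [_ h2] := hP i.
  rewrite -(ltr_nat R) natrX -/P; have : P ^+ k * b 0 i < P ^+ k by rewrite gtr_pMr.
  by lra.
have [h1 h2] := hP i; have /andP[h3 h4] := hx i.
by rewrite -(ler_pM2l (Pgt0 k)) -(ler_pM2l (Pgt0 k) (x 0 i)); apply/andP; split; lra.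
Qed.

(** * The theorem *)

Lemma coprime_gt0 (p d : nat) : (1 < p)%N -> coprime p d -> (0 < d)%N.
Proof. by case: d => // p1; rewrite /coprime gcdn0 => /eqP p1'; rewrite p1' in p1. Qed.

Lemma affine_map_spread (R : realType) (p m n : nat) (Aut : automaton p m n)
    (A : 'M[rat]_(m, n)) (B : 'rV[rat]_n) (a b : 'rV[R]_m) :
  (1 < p)%N -> (0 < m)%N -> admissible p A B -> unit_box a b ->
  (forall x, box a b x -> lifted_plot R Aut (row_mx x (affine_map A B x))) ->
  forall x, lifted_plot R Aut (row_mx x (affine_map A B x)).
Proof.
move=> p1 m0 [Ap Bp] ab Q.
have [E1 [E10 pE1 EA]] := common_denom (r := fun ij => A ij.1 ij.2) p1 (fun ij => Ap ij.1 ij.2).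
have [E2 [E20 pE2 EB]] := common_denom (r := fun j => B 0 j) p1 (fun j => proj1 (andP (Bp j))).
apply: (@affine_spread R p m n Aut a b (E1 * E2)) => //.
- by rewrite muln_gt0 E10.
- by rewrite coprimeMr pE1.
- by move=> i; case: (ab i).
- move=> i j; have [w] := EA (i, j); rewrite mxE /= => /(denom_ratr R) h.
  by exists (E2%:Z * w); rewrite intrM -h -pmulrn natrM; ring.
- move=> j; have [w] := EB j; rewrite mxE /= => /(denom_ratr R) h.
  by exists (E1%:Z * w); rewrite intrM -h -pmulrn natrM; ring.
Qed.

Lemma affine_gradient (R : realType) (m n : nat) (D : set 'rV[R]_m)
    (A : 'M[R]_(m, n)) (B : 'rV[R]_n) x j :
  gradient_within D (fun y => (y *m A + B) 0 j) x (col j A).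
Proof.
move=> e e0; apply: filterE => y.
have -> : (y *m A + B) 0 j - (x *m A + B) 0 j - ((y - x) *m col j A) 0 0 = 0.
  rewrite mulmxBl !mxE.
  have cE (z : 'rV[R]_m) : \sum_i z 0 i * col j A i 0 = \sum_i z 0 i * A i j.
    by apply: eq_bigr => i _; rewrite mxE.
  by rewrite !cE; ring.
by rewrite normr0 mulr_ge0 // ltW.
Qed.

Lemma box_left (R : realType) (m : nat) (a b : 'rV[R]_m) : unit_box a b -> box a b a.
Proof. by move=> ab i; have [_ h _] := ab i; rewrite lexx ltW. Qed.

(** Reducing B modulo 1 puts it in [0, 1) without changing the torus map, and G
    takes its values in [0, 1), so it is recovered by reduction modulo 1. *)
Lemma C2_graph_affine (R : realType) (p m n : nat) (Aut : automaton p m n)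
    (a b : 'rV[R]_m) (G : 'rV[R]_m -> 'rV[R]_n) :
  (1 < p)%N -> (0 < m)%N -> finite_automaton Aut -> unit_box a b ->
  (forall x, box a b x -> forall j, 0 <= G x 0 j < 1) ->
  (forall j, C2_on (box a b) (fun x => G x 0 j)) ->
  (forall x, box a b x -> lifted_plot R Aut (row_mx x (G x))) ->
  exists (A : 'M[rat]_(m, n)) (B : 'rV[rat]_n), admissible p A B /\
    forall x, box a b x -> G x = mod1 (affine_map A B x).
Proof.
move=> p1 m0 Afin ab G01 GC2 Q.
have [N HN] := ex_pigeonhole_bound R p1 m0 Afin.
pose D := slope_denom p N; have pD : coprime p D := coprime_slope_denom p N.
have D0 : (0 < D)%N := coprime_gt0 p1 pD.
have lt_ab i : a 0 i < b 0 i by have [] := ab i.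
have /choice[v /choice[c vcP]] : forall j, exists (v : 'cV[R]_m) (c : R),
    (forall i, exists w : int, D%:R * v i 0 = w%:~R) /\
    forall x, box a b x -> G x 0 j = (x *m v) 0 0 + c.
  move=> j; apply: (int_gradient_affine D0 (GC2 j) (box_left ab)) => x v i xab xv.
  exact: slope_denom_clears i p1 HN lt_ab Q xab xv.
pose A : 'M[R]_(m, n) := \matrix_(i, j) v j i 0.
pose B : 'rV[R]_n := \row_j c j.
have DA i j : exists w : int, D%:R * A i j = w%:~R.
  by rewrite mxE; case: (vcP j).
have GE x : box a b x -> G x = x *m A + B.
  move=> xab; apply/rowP => j; have [_ /(_ x xab) ->] := vcP j.
  by rewrite !mxE; congr (_ + _); apply: eq_bigr => i _; rewrite mxE.
have [k [h [k0 hk hab]]] := ex_inner_cylinder p1 ab.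
pose E := (D * intercept_denom p k N)%N.
have pE : coprime p E by rewrite coprimeMr pD coprime_intercept_denom // ltnW.
have E0 : (0 < E)%N := coprime_gt0 p1 pE.
have EB : forall j, exists w : int, E%:R * B 0 j = w%:~R.
  apply: (intercept_denom_clears p1 HN hk DA) => x /hab xab.
  by rewrite -GE //; apply: Q.
have /choice[A' A'P] : forall ij : 'I_m * 'I_n, exists r : rat, ratr r = A ij.1 ij.2.
  by move=> [i j]; have [w /(denom_rat D0)] := DA i j.
have /choice[B' B'P] : forall j, exists r : rat, ratr r = B 0 j.
  by move=> j; have [w /(denom_rat E0)] := EB j.
pose Aq : 'M[rat]_(m, n) := \matrix_(i, j) A' (i, j).
pose Bq : 'rV[rat]_n := \row_j (B' j - (Num.floor (B' j))%:~R).
exists Aq, Bq; split; first split.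
- move=> i j; have [w Dw] := DA i j; apply: (rat_in_Zp_denom (w := w) pD).
  by rewrite mxE; apply/(denom_ratr R); rewrite A'P.
- move=> j; apply/andP; split.
    have [w Ew] := EB j; apply: (rat_in_Zp_denom (w := w - E%:Z * Num.floor (B' j)) pE).
    rewrite mxE mulrBr intrB intrM -pmulrn; congr (_ - _).
    by apply/(denom_ratr R); rewrite B'P.
  rewrite mxE subr_ge0 floor_le ltrBlDr addrC.
  by have := floorD1_gt (B' j); rewrite intrD.
move=> x xab; apply/rowP => j.
have AE : map_mx ratr Aq = A :> 'M[R]_(m, n) by apply/matrixP => i j'; rewrite !mxE A'P mxE.
have yE : affine_map Aq Bq x 0 j = G x 0 j - (Num.floor (B' j))%:~R.
  rewrite /affine_map AE GE // !affine_row_coord mxE [Bq _ _]mxE rmorphB /= ratr_int B'P.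
  by rewrite addrA.
rewrite mod1E yE.
have -> : Num.floor (G x 0 j - (Num.floor (B' j))%:~R) = - Num.floor (B' j).
  have /andP[g0 g1] := G01 x xab j.
  by apply: floor_def; rewrite intrD intrN; apply/andP; split; lra.
by rewrite intrN opprK subrK.
Qed.

(** The bounds E and M depend on the automaton only, because over the whole space
    the cylinder of depth 1 with leading digits 0 serves for every B. *)
Lemma affine_spread_bounded (R : realType) (p m n : nat) (Aut : automaton p m n) :
  (1 < p)%N -> (0 < m)%N -> finite_automaton Aut -> exists E M : nat, (0 < E)%N /\
  forall (A : 'M[R]_(m, n)) (B : 'rV[R]_n),
    (forall x, lifted_plot R Aut (row_mx x (x *m A + B))) ->
    (forall i j, (exists w : int, E%:R * A i j = w%:~R) /\ `|A i j| <= M%:R) /\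
    (forall j, exists w : int, E%:R * B 0 j = w%:~R).
Proof.
move=> p1 m0 Afin.
have [N HN] := ex_pigeonhole_bound R p1 m0 Afin.
pose D := slope_denom p N; have pD : coprime p D := coprime_slope_denom p N.
pose F := intercept_denom p 1 N.
have pF : coprime p F by rewrite coprime_intercept_denom // ltnW.
exists (D * F)%N, (4 * (N + 2))%N; split.
  by rewrite muln_gt0 !(coprime_gt0 p1).
move=> A B Q.
have DA i j : exists w : int, D%:R * A i j = w%:~R.
  (* Any box serves: the gradient of an affine map is its matrix everywhere. *)
  pose a : 'rV[R]_m := const_mx 0; pose b : 'rV[R]_m := const_mx 1.
  have ab c : a 0 c < b 0 c by rewrite !mxE ltr01.
  have aab : box a b a by move=> c; rewrite lexx ltW.
  have := slope_denom_clears i p1 HN ab (fun x _ => Q x) aab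
    (affine_gradient (box a b) A B a j).
  by rewrite mxE.
split=> [i j|]; last first.
  by apply: (intercept_denom_clears (h := fun=> 0%N) p1 HN _ DA) => // i; rewrite expn_gt0 ltnW.
split; last exact: slope_bound p1 HN Q i j.
have [w wE] := DA i j; exists (F%:Z * w).
by rewrite intrM -wE -pmulrn natrM; ring.
Qed.

Theorem theorem5p5 (R : realType) (p m n : nat)
    (p_prime : prime p) (m_gt0 : (0 < m)%N) (n_gt0 : (0 < n)%N)
    (Aut : automaton p m n) (Aut_fin : finite_automaton Aut) :
  [/\ forall (a b : 'rV[R]_m) (G : 'rV[R]_m -> 'rV[R]_n),
        unit_box a b ->
        (forall x, box a b x -> forall j, 0 <= G x 0 j < 1) ->
        (forall j, C2_on (box a b) (fun x => G x 0 j)) ->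
        torus_graph (box a b) G `<=` torus_plot R Aut ->
        exists (A : 'M[rat]_(m, n)) (B : 'rV[rat]_n),
          admissible p A B /\
          forall x, box a b x -> G x = mod1 (affine_map A B x),
      finite_set [set AB : 'M[rat]_(m, n) * 'rV[rat]_n |
        admissible p AB.1 AB.2 /\
        exists a b : 'rV[R]_m, unit_box a b /\
          torus_graph (box a b) (fun x => mod1 (affine_map AB.1 AB.2 x))
            `<=` torus_plot R Aut] &
      forall (A : 'M[rat]_(m, n)) (B : 'rV[rat]_n),
        admissible p A B ->
        (exists a b : 'rV[R]_m, unit_box a b /\
          torus_graph (box a b) (affine_map A B) `<=` torus_plot R Aut) ->
        torus_graph [set: 'rV[R]_m] (fun x => mod1 (affine_map A B x))
          `<=` torus_plot R Aut].
Proof.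
have p1 := prime_gt1 p_prime; have p0 := ltnW p1.
have boxQ a b (G : 'rV[R]_m -> 'rV[R]_n) :
    torus_graph (box a b) G `<=` torus_plot R Aut ->
    forall x, box a b x -> lifted_plot R Aut (row_mx x (G x)).
  by move=> sub x xab; apply: torus_point_lifted; apply: sub; exists x.
split.
- move=> a b G ab G01 GC2 /boxQ; exact: C2_graph_affine.
- have [E [M [E0 EM]]] := affine_spread_bounded R p1 m_gt0 Aut_fin.
  have fA := finite_bounded_frac_mx m n M E0.
  (* Entries of B lie in [0, 1), hence the bound 1. *)
  have fB := finite_bounded_frac_mx 1 n 1 E0.
  apply: sub_finite_set (finite_setX fA fB) => -[A B] /= [adm [a [b [ab]]]].
  move=> /boxQ Q.
  have Q' x : box a b x -> lifted_plot R Aut (row_mx x (affine_map A B x)).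
    move=> xab; apply: torus_point_lifted; rewrite -(mod1_id (affine_map A B x)).
    exact/lifted_torus_point/Q.
  have [EA EB] := EM _ _ (affine_map_spread p1 m_gt0 adm ab Q').
  split=> [i j|i j] /=.
    have [[w wA] Ab] := EA i j; split.
      by exists w; apply/(denom_ratr R); move: wA; rewrite mxE.
    by move: Ab; rewrite mxE -ratr_norm -(ratr_nat R M) ler_rat.
  rewrite ord1; have [w wB] := EB j; split.
    by exists w; apply/(denom_ratr R); move: wB; rewrite mxE.
  have [_ /(_ j)/andP[_ /andP[B0 B1]]] := adm.
  by rewrite ger0_norm // ltW.
- move=> A B adm [a [b [ab /boxQ Q]]] _ [x _ <-].
  rewrite mod1_id; apply: lifted_torus_point => //.
  exact: affine_map_spread adm ab Q x.
Qed.
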